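(* Let $\mu$ be a standard (mean zero, variance one) probability measure on $\mathbb{R}$ with infinite support and finite moments of all orders. Let $g$ be analytic around zero with $g(0)=0$ and $g'(0)\neq0$, where $g$ is related to a function $\rho$ by $1/\rho(z)=K_\mu(g(z))$ (equivalently $1/g(z)=F_\mu(1/\rho(z))$), with $\rho$ analytic around $0$, $\rho(0)=0$, $\rho'(0)\ne0$, and $(z,x)\mapsto(1-\rho(z)x)^{-1}$ a pre-generating function for $\mu$. Then $$\psi(z,x)=\frac{1}{g(z)\,(K_\mu(g(z))-x)}$$ is a generating function for $\mu$ if and only if $$\frac{\phi_\mu(1/g(z))-\phi_\mu(1/g(v))}{1/g(z)-1/g(v)}$$ depends only on the product $zv$, for $z\ne v$ nonzero in a neighborhood of zero.
   Context: Cauchy-Stieltjes transform: $G_\mu(z)=\int_{\mathbb{R}}\frac{1}{z-x}\,\mu(dx)$ for $z\in\mathbb{C}\setminus\mathrm{supp}(\mu)$, and $F_\mu=1/G_\mu$. The function $F_\mu$ is one-to-one in some neighborhood of infinity; with $F_\mu^{-1}$ its right inverse there, the Voiculescu transform is $\phi_\mu(z)=F_\mu^{-1}(z)-z$. Also $K_\mu(z)=F_\mu^{-1}(1/z)$, so $G_\mu(K_\mu(z))=z$ near $0$, and $R_\mu(z)=\phi_\mu(1/z)=K_\mu(z)-1/z$. Pre-generating function: a series $\phi(z,x)=\sum_{n\ge0}S_n(x)z^n$ (expansion in powers of $z$ around $z=0$) such that $S_n$ is a polynomial of degree $n$ for each $n\geq 0$ and $\limsup_{n\to\infty}\|S_n\|_{L^2(\mu)}<\infty$.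 Generating function: expanding $\psi(z,x)=\sum_{n\ge0}Q_n(x)z^n$ in powers of $z$ around $z=0$, one says that $\psi$ is a generating function for $\mu$ if the polynomials $(Q_n)_{n\ge0}$ are orthogonal with respect to $\mu$. Here $\psi$ is the multiplicative renormalization $\frac{(1-\rho(z)x)^{-1}}{\mathbb{E}[(1-\rho(z)X)^{-1}]}$ of $(1-\rho(z)x)^{-1}$, where $X$ has law $\mu$. An expression in $(z,v)$ depends only on $zv$ if there is a function $\Theta$ of one variable such that the expression equals $\Theta(zv)$ for all admissible $z,v$ in some neighborhood of zero. *)

(* Defs.v *)
From HB Require Import structures.
From mathcomp Require Import all_boot all_order all_algebra.
From mathcomp Require Import all_classical all_reals all_analysis.
From mathcomp Require Export complex.

Set Implicit Arguments.
Unset Strict Implicit.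
Unset Printing Implicit Defensive.

Import Order.TTheory GRing.Theory Num.Theory.
Import numFieldNormedType.Exports.

Local Open Scope classical_set_scope.
Local Open Scope complex_scope.
Local Open Scope ring_scope.

(* [R[i]] seen through [numClosedFieldType], so that the norm topology that the
   library puts on every [numFieldType] is inferred on it. *)
Definition Cplx (R : realType) : numClosedFieldType := R[i].

Definition toC (R : realType) (x : R) : Cplx R := x%:C.

Section Analytic.
Variable R : realType.
Local Notation C := (Cplx R).

Definition sums_to (a : nat -> C) (z l : C) : Prop :=
  series (fun n => a n * z ^+ n) @ \oo --> l.

Definition analytic_at0 (f : C -> C) : Prop :=
  exists a : nat -> C, \forall z \near (0 : C), sums_to a z (f z).

(* The point z = 0 is left out because the functions expanded below are given
   by formulas with a removable singularity at 0. *)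
Definition expands_at0 (f : C -> C) (a : nat -> C) : Prop :=
  \forall z \near (0 : C)^', sums_to a z (f z).

Definition depends_on_product (E : C -> C -> C) : Prop :=
  exists Theta : C -> C,
    \forall z \near (0 : C)^' & v \near (0 : C)^',
      z != v -> E z v = Theta (z * v).

End Analytic.

Section Measures.
Variable R : realType.
Local Notation C := (Cplx R).
Variable mu : probability (measurableTypeR R) R.

Definition measure_support : set R :=
  [set x | forall U : set R, open U -> U x -> (0 < mu U)%E].

Definition cintegral (f : R -> C) : C :=
  Complex (\int[mu]_x complex.Re (f x)) (\int[mu]_x complex.Im (f x)).

Definition L2norm (p : {poly C}) : \bar R :=
  Lnorm mu 2%:E (fun x : measurableTypeR R => (complex.Re `|p.[toC x]|)%:E).

(* The expansion is taken separately for each x: the radius of convergence may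
   depend on x. *)
Definition pre_generating (phi : C -> R -> C) : Prop :=
  exists S : nat -> {poly C},
    [/\ forall x, expands_at0 (phi ^~ x) (fun n => (S n).[toC x]),
        forall n, size (S n) = n.+1 &
        (limn_esup (fun n => L2norm (S n)) < +oo)%E].

(* Orthogonality is that of the complex Hilbert space L^2(mu). *)
Definition generating (psi : C -> R -> C) : Prop :=
  exists Q : nat -> {poly C},
    (forall x, expands_at0 (psi ^~ x) (fun n => (Q n).[toC x])) /\
    (forall m n, m != n ->
       cintegral (fun x => (Q m).[toC x] * ((Q n).[toC x])^*) = 0).

Definition cauchy_stieltjes (z : C) : C :=
  cintegral (fun x => (z - toC x)^-1).

Definition F_transform (z : C) : C := (cauchy_stieltjes z)^-1.

(* The neighborhood |z| > M of infinity, within the domain C \ supp(mu) of the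
   Cauchy-Stieltjes transform. *)
Definition near_infinity (M : R) : set C :=
  [set z | toC M < `|z| /\ forall x, measure_support x -> z != toC x].

(* F_transform is injective near infinity and h is its right inverse there;
   these conditions determine h on a neighborhood of infinity. *)
Definition F_right_inverse (h : C -> C) : Prop :=
  exists M N : R,
    {in near_infinity M &, injective F_transform} /\
    (forall w, toC N < `|w| -> near_infinity M (h w) /\ F_transform (h w) = w).

Definition F_inv : C -> C := xget (fun=> 0) [set h | F_right_inverse h].

Definition voiculescu (z : C) : C := F_inv z - z.

Definition K_transform (z : C) : C := F_inv (z^-1).

End Measures.

(* Main.v *)
Require Import Defs.
From HB Require Import structures.
From mathcomp Require Import all_boot all_order all_algebra.
From mathcomp Require Import all_classical all_reals all_analysis.
From mathcomp Require Import measurable_realfun ring lra.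

Import Order.TTheory GRing.Theory Num.Theory.
Import numFieldNormedType.Exports.

Set Implicit Arguments.
Unset Strict Implicit.
Unset Printing Implicit Defensive.

Local Open Scope classical_set_scope.
Local Open Scope ring_scope.

(** Let X have law mu and put psi(z,x) = 1 / (g(z) (1/rho(z) - x)), where
    1/rho(z) = K(g(z)).  Everything rests on a partial fraction computation.
    Since G(1/rho(z)) = g(z), one has E[psi(z,X)] = 1 and
      E[psi(z,X) psi(v,X)]
        = (1/g(v) - 1/g(z)) / (1/rho(v) - 1/rho(z)) =: H(z,v).
    As phi(1/g(z)) = 1/rho(z) - 1/g(z), the quotient in the theorem is
    1/H(z,v) - 1, so it depends only on zv if and only if H does.  The
    coefficient of z^m v^n in H is E[Q_m(X) Q_n(X)], and H depends only on zv
    exactly when its off-diagonal coefficients vanish.  Orthogonality in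
    L^2(mu) involves the complex conjugate of Q_n instead; but Q_n has degree
    n and the moments are real, so both forms of orthogonality say that Q_n is
    orthogonal to all polynomials of smaller degree ([momf_orthogonal_conj]).

    The function psi(z,.) psi(v,.) is never integrated.  Let L p = E[p(X)], a
    functional on polynomials.  The equation x rho(z) psi = psi - rho(z)/g(z)
    is a linear recursion for the polynomials Q_n ([gpoly_rec]); read at the
    point v, it is also a recursion for the numbers E[X^k psi(v,X)], which are
    therefore explicit rational expressions in rho(v), g(v) and the moments
    ([kmom]).  Calling L_v the functional on polynomials with these moments,
    division of one-variable power series ([psum_quotient]) gives
      sum_n L_v(Q_n) z^n = H(z,v)        ([gen_kernel_expansion]),
      sum_n L(p Q_n) v^n = L_v(p)        ([kmom_expansion]).
    The one analytic input about mu is L(Q_n) = 0 for n > 0 and L(Q_0) = 1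
    ([gpoly_mean]).  It is read off the asymptotic expansion of G at infinity,
    whose coefficients are the moments; this expansion is valid away from the
    real axis ([cauchy_stieltjes_asymptotics]), so it is used along a ray on
    which 1/rho(z) is almost imaginary.

    If H is a function of zv then H(z,v) = H(z/2,2v), and comparing the
    coefficients of z^m v^n gives L(Q_m Q_n) = 2^(n-m) L(Q_m Q_n)
    ([orthogonal_of_product_kernel]).  Conversely, if the off-diagonal
    coefficients vanish then H(z,v) = T(zv) with T(w) = sum_n L(Q_n^2) w^n;
    here the convergence has to be obtained on a neighborhood of zero that is
    the same for all v ([product_kernel_of_orthogonal]).

    The inverse of F chosen in the definition of K exists: otherwise K would
    vanish identically, against 1/rho(z) = K(g(z)) ([F_inv_right_inverse]). *)

(** * The modulus as a real number, and limits in the complex plane *)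

Section Modulus.
Variable R : realType.
Local Notation C := (Cplx R).
Implicit Types (z w : C) (x y : R).

(** A real-valued modulus: the norm of [C] takes values in [C], where the order
    is only partial. *)
Definition cabs z : R := complex.Re `|z|.

Lemma toC_cabs z : toC (cabs z) = `|z|.
Proof. exact: (@RRe_real R `|z| (normr_real (z : C))). Qed.

Lemma toC_inj : injective (@toC R).
Proof. by move=> x y []. Qed.

Lemma toCD x y : toC (x + y) = toC x + toC y.
Proof. exact: (rmorphD (real_complex R)). Qed.
Lemma toCM x y : toC (x * y) = toC x * toC y.
Proof. exact: (rmorphM (real_complex R)). Qed.
Lemma toCX x n : toC (x ^+ n) = toC x ^+ n.
Proof. exact: (rmorphXn (real_complex R)). Qed.
Lemma toCV x : toC x^-1 = (toC x)^-1.
Proof. exact: (fmorphV (real_complex R)). Qed.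
Lemma toC_nat n : toC (n%:R : R) = n%:R.
Proof. exact: (rmorph_nat (real_complex R)). Qed.
Lemma toC0 : toC 0 = 0 :> C. Proof. by []. Qed.
Lemma conj_toC x : (toC x)^* = toC x.
Proof. by rewrite -[LHS]/(Complex x (- 0)) oppr0. Qed.

Lemma ler_toC x y : (toC x <= toC y) = (x <= y).
Proof. exact: lecR. Qed.
Lemma ltr_toC x y : (toC x < toC y) = (x < y).
Proof. exact: ltcR. Qed.

Lemma cabs_ge0 z : 0 <= cabs z.
Proof. by rewrite -ler_toC toC_cabs toC0. Qed.
Lemma cabs0 : cabs 0 = 0.
Proof. by apply: toC_inj; rewrite toC_cabs normr0. Qed.
Lemma cabs_eq0 z : (cabs z == 0) = (z == 0).
Proof.
apply/eqP/eqP => [h|->]; last exact: cabs0.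
by apply/normr0_eq0; rewrite -toC_cabs h.
Qed.
Lemma cabs_gt0 z : (0 < cabs z) = (z != 0).
Proof. by rewrite lt_def cabs_ge0 andbT cabs_eq0. Qed.
Lemma cabsM z w : cabs (z * w) = cabs z * cabs w.
Proof. by apply: toC_inj; rewrite toCM !toC_cabs normrM. Qed.
Lemma cabsX z n : cabs (z ^+ n) = cabs z ^+ n.
Proof. by apply: toC_inj; rewrite toCX !toC_cabs normrX. Qed.
Lemma cabsV z : cabs z^-1 = (cabs z)^-1.
Proof. by apply: toC_inj; rewrite toCV !toC_cabs normfV. Qed.
Lemma cabsN z : cabs (- z) = cabs z.
Proof. by apply: toC_inj; rewrite !toC_cabs normrN. Qed.
Lemma cabsC z w : cabs (z - w) = cabs (w - z).
Proof. by rewrite -cabsN opprB. Qed.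
Lemma cabsD z w : cabs (z + w) <= cabs z + cabs w.
Proof. by rewrite -ler_toC toCD !toC_cabs ler_normD. Qed.
Lemma cabsB z w : cabs (z - w) <= cabs z + cabs w.
Proof. by rewrite -(cabsN w) cabsD. Qed.
Lemma cabs_toC x : cabs (toC x) = `|x|.
Proof.
rewrite /cabs -[`|toC x|]/(`|x%:C%C|) normc_def /=.
by rewrite expr0n addr0 sqrtr_sqr.
Qed.
Lemma cabs_sum (I : Type) (r : seq I) (P : pred I) (F : I -> C) :
  cabs (\sum_(i <- r | P i) F i) <= \sum_(i <- r | P i) cabs (F i).
Proof.
elim/big_ind2: _ => [|x1 x2 y1 y2 h1 h2|//]; first by rewrite cabs0.
exact: le_trans (cabsD _ _) (lerD h1 h2).
Qed.

Lemma near0P (P : C -> Prop) :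
  (\forall z \near (0 : C), P z) <->
  exists2 r, 0 < r & forall z, cabs z < r -> P z.
Proof.
split=> [/nbhs_normP[e /= e0 h]|[r r0 h]].
  have eE : toC (cabs e) = e by rewrite toC_cabs ger0_norm // ltW.
  exists (cabs e) => [|z hz]; first by rewrite -ltr_toC eE.
  apply: h => /=; rewrite /ball_ sub0r normrN.
  by rewrite -toC_cabs -eE ltr_toC.
apply/nbhs_normP; exists (toC r) => /=; first by rewrite ltr_toC.
move=> z /=; rewrite sub0r normrN -toC_cabs ltr_toC => hz; exact: h.
Qed.

Lemma dnear0P (P : C -> Prop) :
  (\forall z \near (0 : C)^', P z) <->
  exists2 r, 0 < r & forall z, z != 0 -> cabs z < r -> P z.
Proof.
have <- : (\forall z \near (0 : C), z != 0 -> P z) =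
          (\forall z \near (0 : C)^', P z) by [].
split=> [/near0P[r r0 h]|[r r0 h]].
  by exists r => // z z0 hz; apply: h.
by apply/near0P; exists r => // z hz z0; apply: h.
Qed.

Lemma dnear0_2P (P : C -> C -> Prop) :
  (\forall z \near (0 : C)^' & v \near (0 : C)^', P z v) <->
  exists2 r, 0 < r & forall z v, z != 0 -> v != 0 ->
    cabs z < r -> cabs v < r -> P z v.
Proof.
split=> [[[A B] /= [/dnear0P[r r0 hr] /dnear0P[s s0 hs]] h]|[r r0 h]].
  exists (Num.min r s) => [|z v z0 v0]; first by rewrite lt_min r0.
  rewrite !lt_min => /andP[zr _] /andP[_ vs].
  by apply: (h (z, v)); split; [apply: hr|apply: hs].
exists ([set z | z != 0 /\ cabs z < r], [set z | z != 0 /\ cabs z < r]) => /=.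
  by split; apply/dnear0P; exists r.
by move=> [z v] /= [[z0 zr] [v0 vr]]; apply: h.
Qed.

Lemma cvg_cabsP (u : nat -> C) (l : C) :
  u @ \oo --> l <-> cabs (u n - l) @[n --> \oo] --> (0 : R).
Proof.
split=> [/cvgrPdist_lt h|/cvgrPdist_lt h]; apply/cvgrPdist_lt => e e0.
  have := h (toC e); rewrite ltr_toC => /(_ e0).
  apply: filterS => n; rewrite -toC_cabs ltr_toC cabsC => hn.
  by rewrite sub0r normrN ger0_norm // cabs_ge0.
have eE : toC (cabs e) = e by rewrite toC_cabs ger0_norm // ltW.
have /h : 0 < cabs e by rewrite -ltr_toC eE.
apply: filterS => n; rewrite sub0r normrN ger0_norm ?cabs_ge0// => hn.
by rewrite -toC_cabs -eE ltr_toC cabsC.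
Qed.

Lemma cvg_cabs_le (u : nat -> C) (l : C) (e : nat -> R) :
  (forall n, cabs (u n - l) <= e n) -> e @ \oo --> (0 : R) -> u @ \oo --> l.
Proof.
move=> h he; apply/cvg_cabsP.
apply: squeeze_cvgr (cvg_cst 0) he.
by apply: nearW => n; rewrite cabs_ge0 h.
Qed.

Lemma cabs_lim_le (u : nat -> C) (l w : C) (B : R) (N : nat) :
  u @ \oo --> l -> (forall n, (N <= n)%N -> cabs (u n - w) <= B) ->
  cabs (l - w) <= B.
Proof.
move=> /cvg_cabsP ul h; apply/ler_addgt0Pr => e e0.
have /cvgrPdist_lt /(_ e e0) [M _ hM] := ul.
have := hM (maxn M N) (leq_maxl _ _).
rewrite sub0r normrN ger0_norm ?cabs_ge0// => h1.
have h2 := h _ (leq_maxr M N).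
rewrite -(subrK (u (maxn M N)) l) -addrA.
apply: le_trans (cabsD _ _) _; rewrite [leRHS]addrC; apply: lerD => //.
by rewrite cabsC ltW.
Qed.

End Modulus.

(** * Sums of power series *)

Section PowerSeries.
Variable R : realType.
Local Notation C := (Cplx R).
Implicit Types (a b s t : nat -> C) (z w l : C) (f h : C -> C).

(** The sum of the series is prescribed on an open disc of given radius, so
    that radii can be compared and shared between functions. *)
Definition psum a (r : R) f := forall z, cabs z < r -> sums_to a z (f z).

Definition cprod a b (n : nat) : C := \sum_(i < n.+1) a i * b (n - i)%N.

Lemma geometric_sum_le (q : R) n : 0 <= q < 1 ->
  \sum_(i < n) q ^+ i <= (1 - q)^-1.
Proof.
move=> /andP[q0 q1]; have q1' : 0 < 1 - q by rewrite subr_gt0.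
rewrite -[leRHS]mul1r ler_pdivlMr// mulrC -opprB mulNr -subrX1 opprB.
by rewrite gerBl exprn_ge0.
Qed.

(** The terms are differences of partial sums that are eventually close to the
    limit. *)
Lemma sums_to_term_bounded a z l : sums_to a z l ->
  exists2 A : R, 0 < A & forall n, cabs (a n) * cabs z ^+ n <= A.
Proof.
move=> /cvg_cabsP /cvgrPdist_lt /(_ 1 ltr01) [M _ hM].
have hM' n : (M <= n)%N ->
    cabs (series (fun n => a n * z ^+ n) n - l) < 1.
  by move=> /hM; rewrite /= sub0r normrN ger0_norm ?cabs_ge0.
exists (2 + \sum_(i < M) cabs (a i) * cabs z ^+ i) => [|n].
  by rewrite ltr_wpDr// sumr_ge0// => i _; rewrite mulr_ge0 ?exprn_ge0 ?cabs_ge0.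
have [nM|nM] := ltnP n M.
  rewrite (bigD1 (Ordinal nM)) //= addrCA lerDl addr_ge0// sumr_ge0// => i _.
  by rewrite mulr_ge0 ?exprn_ge0 ?cabs_ge0.
apply: (@le_trans _ _ 2); last first.
  by rewrite lerDl sumr_ge0// => i _; rewrite mulr_ge0 ?exprn_ge0 ?cabs_ge0.
rewrite -cabsX -cabsM.
have -> : a n * z ^+ n = series (fun n => a n * z ^+ n) n.+1 - l
   - (series (fun n => a n * z ^+ n) n - l).
  by rewrite /series /= big_nat_recr//=; ring.
apply: le_trans (cabsB _ _) _.
have h1 := hM' n nM; have h2 := hM' n.+1 (leqW nM); lra.
Qed.

Lemma psum_coef_bound a r f (s : R) : psum a r f -> 0 < s < r ->
  exists2 A : R, 0 < A & forall n, cabs (a n) <= A * s^-1 ^+ n.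
Proof.
move=> h /andP[s0 sr].
have ns : cabs (toC s) = s by rewrite cabs_toC gtr0_norm.
have /h/sums_to_term_bounded [A A0 hA] : cabs (toC s) < r by rewrite ns.
exists A => // n; have := hA n; rewrite ns.
by rewrite exprVn -ler_pdivlMr ?exprn_gt0.
Qed.

Lemma sums_to_bound a z l (A B : R) : 0 <= A -> 0 <= B ->
  (forall n, cabs (a n) <= A * B ^+ n) -> sums_to a z l ->
  B * cabs z <= 2^-1 -> cabs l <= 2 * A.
Proof.
move=> A0 B0 hA hl hz; rewrite -(subr0 l).
apply: (@cabs_lim_le _ _ _ _ _ 0%N hl) => n _; rewrite subr0 /series /=.
rewrite big_mkord; apply: le_trans (cabs_sum _ _ _) _.
apply: (@le_trans _ _ (\sum_(i < n) A * 2^-1 ^+ i)).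
  apply: ler_sum => i _; rewrite cabsM cabsX.
  apply: (@le_trans _ _ (A * (B * cabs z) ^+ i)).
    by rewrite exprMn mulrA ler_wpM2r// exprn_ge0 ?cabs_ge0.
  rewrite ler_wpM2l//; apply: lerXn2r => //; rewrite nnegrE ?invr_ge0//.
  by rewrite mulr_ge0 ?cabs_ge0.
rewrite -mulr_sumr [leRHS]mulrC ler_wpM2l//.
apply: le_trans (geometric_sum_le _ _) _; first by lra.
by rewrite (_ : (1 - 2^-1)^-1 = 2)//; field.
Qed.

Lemma sums_to_ext a b z l : a =1 b -> sums_to a z l -> sums_to b z l.
Proof. by move=> /funext ->. Qed.

Lemma sums_to_unique a z l l' : sums_to a z l -> sums_to a z l' -> l = l'.
Proof. exact: cvg_unique. Qed.

Lemma sums_to_at0 a : sums_to a 0 (a 0%N).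
Proof.
apply/cvg_cabsP; apply: (@cvg_trans _ ((fun=> 0 : R) @ \oo)); last exact: cvg_cst.
apply: near_eq_cvg; exists 1%N => // -[//|n] _.
rewrite /series /= big_nat_recl//= expr0 mulr1 big1 ?addr0 ?subrr ?cabs0// => i _.
by rewrite exprS mul0r mulr0.
Qed.

Lemma psum0E a r f : 0 < r -> psum a r f -> f 0 = a 0%N.
Proof.

move=> r0 h; apply: (sums_to_unique _ (@sums_to_at0 a)).
by apply: h; rewrite cabs0.
Qed.

Lemma sums_toD a b z l l' : sums_to a z l -> sums_to b z l' ->
  sums_to (fun n => a n + b n) z (l + l').
Proof.
move=> ha hb; rewrite /sums_to.
have -> : series (fun n => (a n + b n) * z ^+ n) =
   series (fun n => a n * z ^+ n) \+ series (fun n => b n * z ^+ n).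
  by apply/funext => n; rewrite /series /= -big_split /=; apply: eq_bigr => i _;
    rewrite mulrDl.
exact: (cvgD ha hb).
Qed.

Lemma sums_toZ c a z l : sums_to a z l -> sums_to (fun n => c * a n) z (c * l).
Proof.
move=> ha; rewrite /sums_to.
have -> : series (fun n => (c * a n) * z ^+ n) =
   (fun n => c * series (fun n => a n * z ^+ n) n).
  by apply/funext => n; rewrite /series /= mulr_sumr; apply: eq_bigr => i _;
    rewrite mulrA.
exact: cvgM (cvg_cst _) ha.
Qed.

Lemma sums_to_scale c a z l : sums_to a (c * z) l ->
  sums_to (fun n => c ^+ n * a n) z l.
Proof.
rewrite /sums_to; set u := fun n => _; set v := fun n => _.
suff -> : u = v by [].
by apply/funext => n; rewrite /u /v exprMn mulrA [a n * _]mulrC.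
Qed.

Lemma sums_to_tail a z l : z != 0 -> sums_to a z l ->
  sums_to (fun n => a n.+1) z ((l - a 0%N) / z).
Proof.
move=> z0 ha; rewrite /sums_to.
have -> : series (fun n => a n.+1 * z ^+ n) =
   (fun n => (series (fun n => a n * z ^+ n) n.+1 - a 0%N) / z).
  apply/funext => n; rewrite /series /= big_nat_recl//= expr0 mulr1 addrAC.
  rewrite subrr add0r mulr_suml; apply: eq_bigr => i _.
  by rewrite exprS -mulrA; congr (_ * _); rewrite mulrAC divff// mul1r.
apply: cvgM; last exact: cvg_cst.
apply: cvgB; last exact: cvg_cst.
have := ha; rewrite /sums_to -(cvg_shiftS _) => h; exact: h.
Qed.

(** A power series is its constant term plus z times a power series with the
    same disc: this replaces Taylor expansion throughout. *)
Lemma psum_tail a r f : psum a r f -> exists2 f1 : C -> C,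
  psum (fun n => a n.+1) r f1 &
  forall z, cabs z < r -> f z = a 0%N + z * f1 z.
Proof.
move=> h; exists (fun z => if z == 0 then a 1%N else (f z - a 0%N) / z).
  move=> z zr; case: eqP => [->|/eqP z0]; last exact: sums_to_tail (h z zr).
  exact: (@sums_to_at0 (fun n => a n.+1)).
move=> z zr; have [z0|z0] := eqVneq z 0.
  rewrite mulrC z0 mulr0 addr0; apply: psum0E h.
  by move: zr; rewrite z0 cabs0.
by rewrite mulrC divfK// addrC subrK.
Qed.

Lemma psum_bounded a r f : 0 < r -> psum a r f ->
  exists2 A : R, 0 < A & exists2 d, 0 < d &
    forall z, cabs z < d -> cabs (f z) <= A.
Proof.
move=> r0 h; have [] := psum_coef_bound (s := r / 2) h; first by lra.
move=> A A0 hA; exists (2 * A); first by lra.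
exists (r / 4) => [|z hz]; first by lra.
apply: (sums_to_bound (ltW A0) _ hA); first by rewrite invr_ge0; lra.
  by apply: h; lra.
rewrite mulrC ler_pdivrMr; last by lra.
by lra.
Qed.

(** Vanishing to order N along a single ray kills the first N coefficients: the
    constant term is at most O(x), hence zero, and dividing by z lowers the
    order by one. A ray is all that the asymptotics of the Cauchy-Stieltjes
    transform will provide. *)
Lemma psum_ray_coef0 (u : C) N a r f (K d : R) : u != 0 -> 0 < r ->
  psum a r f -> 0 < d ->
  (forall x : R, 0 < x < d -> cabs (f (toC x * u)) <= K * x ^+ N) ->
  forall n, (n < N)%N -> a n = 0.
Proof.
move=> u0 r0; have cu0 : 0 < cabs u by rewrite cabs_gt0.
elim: N a f K d => [//|N IH] a f K d h d0 hK.
have [f1 h1 f1E] := psum_tail h.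
have [A A0 [e e0 hA]] := psum_bounded r0 h1.
have ctu x : 0 < x -> cabs (toC x * u) = x * cabs u.
  by move=> x0; rewrite cabsM cabs_toC gtr0_norm.
have [d' d'0 hd'] : exists2 d', 0 < d' & forall x, 0 < x < d' ->
    [/\ x < d, x < 1, x * cabs u < r & x * cabs u < e].
  exists (Num.min (Num.min d 1) (Num.min r e / cabs u)).
    by rewrite !lt_min d0 ltr01 /= divr_gt0// lt_min r0.
  move=> x /andP[x0]; rewrite !lt_min ltr_pdivlMr// lt_min.
  by move=> /andP[/andP[-> ->] /andP[-> ->]].
have K0 : 0 <= K.
  rewrite leNgt; apply/negP => K0.
  have /hK : 0 < d / 2 < d by lra.
  apply/negP; rewrite -ltNge; apply: lt_le_trans (cabs_ge0 _).
  by rewrite pmulr_llt0// exprn_gt0//; lra.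
have a0 : a 0%N = 0.
  apply/eqP; rewrite -cabs_eq0 eq_le cabs_ge0 andbT.
  apply/ler_addgt0Pr => eps eps0; rewrite add0r.
  pose x := Num.min (d' / 2) (eps / (K + cabs u * A)).
  have KA0 : 0 < K + cabs u * A by rewrite ltr_wpDl// mulr_gt0.
  have x0 : 0 < x by rewrite lt_min !divr_gt0.
  have xd : x < d' by rewrite gt_min; apply/orP; left; lra.
  have /hd'[xd1 x1 xr xe] : 0 < x < d' by rewrite x0.
  have -> : a 0%N = f (toC x * u) - toC x * u * f1 (toC x * u).
    by rewrite f1E ?ctu// addrK.
  apply: le_trans (cabsB _ _) _.
  apply: (@le_trans _ _ (K * x + x * cabs u * A)).
    apply: lerD; last first.
      rewrite cabsM ctu// ler_wpM2l ?mulr_ge0 ?(ltW x0) ?cabs_ge0//.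
      by apply: hA; rewrite ctu.
    apply: le_trans (hK _ _) _; first by rewrite x0.
    rewrite ler_wpM2l// exprS -[leRHS]mulr1 ler_wpM2l// ?(ltW x0)//.
    by rewrite exprn_ile1// ltW.
  have -> : K * x + x * cabs u * A = x * (K + cabs u * A) by ring.
  by rewrite -ler_pdivlMr// ge_min lexx orbT.
case=> [//|n] nN; apply: (IH (fun n => a n.+1) f1 (K / cabs u) d') => // x.
move=> /[dup] xd' /hd'[xd x1 xr xe]; move: xd' => /andP[x0 _].
have := hK x; rewrite x0 xd => /(_ isT).
rewrite f1E ?ctu// a0 add0r cabsM ctu// exprS => hh.
rewrite mulrAC ler_pdivlMr// -(ler_pM2l x0).
by rewrite [leRHS]mulrCA (le_trans _ hh)// mulrA [leRHS]mulrAC.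
Qed.

Lemma psum_near0_coef0 a r f : 0 < r -> psum a r f ->
  (\forall z \near (0 : C)^', f z = 0) -> forall n, a n = 0.
Proof.
move=> r0 h /dnear0P[d d0 hd] n.
apply: (@psum_ray_coef0 1 n.+1 a r f 0 d) => //.
move=> x /andP[x0 xd]; rewrite mulr1 hd ?cabs0 ?mul0r//.
  by rewrite -cabs_gt0 cabs_toC gtr0_norm.
by rewrite cabs_toC gtr0_norm.
Qed.

End PowerSeries.

(** * Products of power series *)

Section CauchyProduct.
Variable R : realType.
Local Notation C := (Cplx R).
Implicit Types (a b s t : nat -> C) (z w l : C) (f h : C -> C).

Lemma cprod_partial_sum a b N :
  \sum_(n < N) cprod a b n = \sum_(i < N) a i * \sum_(j < N - i) b j.
Proof.
elim: N => [|N IH]; first by rewrite !big_ord0.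
rewrite big_ord_recr /= IH [in RHS]big_ord_recr /= subSnn big_ord1.
rewrite /cprod big_ord_recr /= subnn addrA; congr (_ + _).
rewrite -big_split /=; apply: eq_bigr => i _.
by rewrite subSn ?(ltnW (ltn_ord i))// big_ord_recr /= mulrDr.
Qed.

Lemma cprod_scale a b z n :
  cprod (fun n => a n * z ^+ n) (fun n => b n * z ^+ n) n =
  cprod a b n * z ^+ n.
Proof.
rewrite /cprod mulr_suml; apply: eq_bigr => i _.
by rewrite mulrACA -exprD subnKC// -ltnS.
Qed.

(** A geometric factor absorbs a linear one at the cost of a square root of the
    ratio, because q ^+ N is below every term of the geometric sum. *)
Lemma natr_geometric_le (q : R) N : 0 <= q < 1 ->
  N%:R * (q ^+ 2) ^+ N <= (1 - q)^-1 * q ^+ N.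
Proof.
move=> /[dup] hq /andP[q0 q1].
rewrite -exprM mulnC exprM expr2 mulrA ler_wpM2r ?exprn_ge0//.
apply: le_trans (geometric_sum_le N hq).
rewrite mulr_natl (_ : _ *+ N = \sum_(i < N) q ^+ N); last first.
  by rewrite sumr_const card_ord.
apply: ler_sum => i _.
by rewrite ler_wiXn2l ?(ltW q1) ?(ltnW (ltn_ord i)).
Qed.

(** The product of partial sums differs from the partial sum of the Cauchy
    product by N tails, each of order q ^+ (2 N). The conclusion concerns the
    difference only, without assuming that the series converge: [psum_quotient]
    needs it for a series whose convergence is still unknown. *)
Lemma mertens a b (A q : R) : 0 <= A -> 0 <= q < 1 ->
  (forall n, cabs (a n) <= A * (q ^+ 2) ^+ n) ->
  (forall n, cabs (b n) <= A * (q ^+ 2) ^+ n) ->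
  (series a n * series b n - series (cprod a b) n) @[n --> \oo] --> (0 : C).
Proof.
move=> A0 /[dup] hq /andP[q0 q1] ha hb.
set p := q ^+ 2 in ha hb.
have p0 : 0 <= p by rewrite exprn_ge0.
have p1 : p < 1 by rewrite /p expr_lt1.
pose K := A * A * (1 - p)^-1 * (1 - q)^-1.
apply: (@cvg_cabs_le _ _ _ (fun n => K * q ^+ n)); last first.
  by apply: cvg_geometric; rewrite ger0_norm.
move=> N; rewrite subr0 /series /= !big_mkord cprod_partial_sum mulr_suml -sumrB.
apply: le_trans (cabs_sum _ _ _) _.
apply: (@le_trans _ _ (\sum_(i < N) A * A * (1 - p)^-1 * p ^+ N)).
  apply: ler_sum => i _; rewrite -mulrBr cabsM.
  have -> : \sum_(j < N) b j - \sum_(j < N - i) b j =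
      \sum_(k < i) b (N - i + k)%N.
    have iN : (N = (N - i) + i)%N by rewrite subnK// ltnW.
    rewrite [in X in X - _]iN big_split_ord /= addrAC subrr add0r.
    by [].
  apply: (@le_trans _ _ (A * p ^+ i * (A * p ^+ (N - i) * (1 - p)^-1))).
    apply: ler_pM; rewrite ?cabs_ge0//.
    apply: le_trans (cabs_sum _ _ _) _.
    apply: (@le_trans _ _ (\sum_(k < i) A * p ^+ (N - i) * p ^+ k)).
      by apply: ler_sum => k _; rewrite -mulrA -exprD.
    rewrite -mulr_sumr ler_wpM2l ?mulr_ge0 ?exprn_ge0//.
    by apply: geometric_sum_le; rewrite p0.
  have -> : p ^+ N = p ^+ i * p ^+ (N - i) by rewrite -exprD subnKC// ltnW.
  by rewrite le_eqVlt; apply/orP; left; apply/eqP; ring.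
rewrite sumr_const card_ord -mulr_natr.
have -> : A * A * (1 - p)^-1 * p ^+ N * N%:R =
    A * A * (1 - p)^-1 * (N%:R * p ^+ N) by ring.
rewrite /K -[leRHS]mulrA ler_wpM2l ?natr_geometric_le//.
by rewrite !mulr_ge0// invr_ge0 subr_ge0 ltW.
Qed.

Lemma cvg_diff0 (u v : nat -> C) l :
  u @ \oo --> l -> (u n - v n) @[n --> \oo] --> (0 : C) -> v @ \oo --> l.
Proof.
move=> hu huv; have -> : v = (fun n => u n - (u n - v n)).
  by apply/funext => n; rewrite subKr.
have h := cvgB hu huv.
rewrite subr0 in h; exact: h.
Qed.

(** The radius is preserved: at z, geometric bounds come from any radius
    strictly between the modulus of z and r. *)
Lemma psumM a b (r : R) f h : psum a r f -> psum b r h ->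
  psum (cprod a b) r (fun z => f z * h z).
Proof.
move=> ha hb z zr.
have z0 := cabs_ge0 z.
pose s := (cabs z + r) / 2.
have s0 : 0 < s by rewrite /s; lra.
have hs : 0 < s < r by rewrite s0 /s; lra.
have [A A0 hA] := psum_coef_bound ha hs.
have [B B0 hB] := psum_coef_bound hb hs.
(* [mertens] takes the bounds in terms of the square of q *)
pose q := Num.sqrt (cabs z / s).
have qE : q ^+ 2 = cabs z / s by rewrite sqr_sqrtr// divr_ge0// ltW.
have hq : 0 <= q < 1.
  rewrite sqrtr_ge0 /= -sqrtr1 ltr_sqrt// ltr_pdivrMr// mul1r /s.
  by lra.
have bnd c K K' : 0 <= K' -> (forall n, cabs (c n) <= K * s^-1 ^+ n) -> forall n,
    cabs (c n * z ^+ n) <= (K + K') * (q ^+ 2) ^+ n.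
  move=> K'0 hc n; rewrite cabsM cabsX qE exprMn mulrA.
  rewrite -mulrA [_ * s^-1 ^+ n]mulrC mulrA ler_wpM2r ?exprn_ge0//.
  apply: le_trans (hc n) _; rewrite ler_wpM2r ?exprn_ge0 ?invr_ge0 ?(ltW s0)//.
  by rewrite lerDl.
have hm := mertens (ltW (addr_gt0 A0 B0)) hq
  (bnd a A B (ltW B0) hA).
have hb' : forall n, cabs (b n * z ^+ n) <= (A + B) * (q ^+ 2) ^+ n.
  by rewrite [A + B]addrC; apply: bnd => //; exact: ltW.
have := hm _ hb'; rewrite (_ : cprod _ _ = fun n => cprod a b n * z ^+ n); last first.
  by apply/funext => n; exact: cprod_scale.
by apply: cvg_diff0; exact: cvgM (ha z zr) (hb z zr).
Qed.

Lemma psum_neq0 b (r : R) f : 0 < r -> psum b r f -> b 0%N != 0 ->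
  exists2 d : R, 0 < d & forall z, cabs z < d -> f z != 0.
Proof.
move=> r0 hb b0; have [f1 h1 fE] := psum_tail hb.
have [K K0 [e e0 hK]] := psum_bounded r0 h1.
have c0 : 0 < cabs (b 0%N) by rewrite cabs_gt0.
exists (Num.min (Num.min r e) (cabs (b 0%N) / K)).
  by rewrite !lt_min r0 e0 divr_gt0.
move=> z; rewrite !lt_min => /andP[/andP[zr ze]]; rewrite ltr_pdivlMr// => zK.
apply/eqP => fz; have : cabs (b 0%N) <= cabs z * K.
  have -> : b 0%N = - (z * f1 z) by apply/eqP; rewrite -addr_eq0 -fE// fz.
  by rewrite cabsN cabsM ler_wpM2l ?cabs_ge0// hK.
by rewrite leNgt zK.
Qed.

End CauchyProduct.

(** * Quotients of power series and local injectivity *)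

Section Division.
Variable R : realType.
Local Notation C := (Cplx R).
Implicit Types (a b s t : nat -> C) (z w l : C) (f h : C -> C).

Lemma cprod_quotient_exists b t : b 0%N != 0 ->
  exists s, forall n, cprod b s n = t n.
Proof.
move=> b0.
pose step (p : seq C) m : C :=
  (t m - \sum_(i < m) b i.+1 * nth 0 p (m - i.+1)%N) / b 0%N.
pose p := fix p n : seq C :=
  if n is m.+1 then rcons (p m) (step (p m) m) else [::].
have sz n : size (p n) = n by elim: n => //= n IH; rewrite size_rcons IH.
have pn m n k : (k < m)%N -> (m <= n)%N -> nth 0 (p n) k = nth 0 (p m) k.
  move=> km; elim: n => [|n IH]; first by rewrite leqn0 => /eqP ->.
  rewrite leq_eqVlt => /predU1P[->//|]; rewrite ltnS => mn /=.
  by rewrite nth_rcons sz (leq_trans km mn) IH.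
exists (fun n => nth 0 (p n.+1) n) => n.
rewrite /cprod big_ord_recl subn0 [X in _ * X]/= nth_rcons sz ltnn eqxx.
rewrite /step mulrC divfK// -[RHS](subrK (\sum_(i < n) b i.+1 * nth 0 (p n) (n - i.+1)%N)).
congr (_ + _); apply: eq_bigr => i _; congr (_ * _).
by rewrite lift0 (@pn (n - i.+1).+1 n)// subnSK// leq_subr.
Qed.

(** The recursion for the coefficients of a quotient preserves a geometric
    bound once its ratio D is so large that the contribution of the earlier
    coefficients is at most half of what is allowed. *)
Lemma cprod_quotient_bound b s t (A B : R) : 0 < A -> 0 < B ->
  b 0%N != 0 ->
  (forall n, cabs (b n) <= A * B ^+ n) ->
  (forall n, cabs (t n) <= A * B ^+ n) ->
  (forall n, cprod b s n = t n) ->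
  exists K D : R, [/\ 0 < K, B <= D & forall n, cabs (s n) <= K * D ^+ n].
Proof.
move=> A0 B0 b0 hb ht hs.
have c0 : 0 < cabs (b 0%N) by rewrite cabs_gt0.
(* e is the ratio B / D; the second bound makes the sum over the earlier
   coefficients at most half of K * cabs (b 0) *)
pose e := Num.min (1 / 2) (cabs (b 0%N) / (4 * A)).
have e0 : 0 < e by rewrite lt_min !divr_gt0// mulr_gt0.
have e1 : e <= 1 / 2 by rewrite ge_min lexx.
have e2 : e * (4 * A) <= cabs (b 0%N).
  by rewrite -ler_pdivlMr ?mulr_gt0// ge_min lexx orbT.
pose D := B / e.
have BD : B = e * D by rewrite /D mulrC divfK// gt_eqF.
have D0 : 0 < D by rewrite divr_gt0.
pose K := 2 * A / cabs (b 0%N).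
have K0 : 0 < K by rewrite divr_gt0// mulr_gt0.
have KE : K * cabs (b 0%N) = 2 * A by rewrite /K divfK// gt_eqF.
clearbody K.
exists K, D; split => //.
  by rewrite BD ger_pMl//; lra.
elim/ltn_ind => n IH; rewrite -(ler_pM2r c0) -cabsM mulrC.
have -> : b 0%N * s n = t n - \sum_(i < n) b i.+1 * s (n - i.+1)%N.
  by rewrite -hs /cprod big_ord_recl subn0 addrK.
rewrite mulrAC KE.
apply: le_trans (cabsB _ _) _.
have -> : 2 * A * D ^+ n = A * D ^+ n + A * D ^+ n by ring.
apply: lerD.
  apply: le_trans (ht n) _; rewrite ler_wpM2l ?(ltW A0)// BD exprMn.
  by rewrite ler_piMl ?exprn_ge0 ?(ltW D0)// exprn_ile1 ?(ltW e0)//; lra.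
apply: le_trans (cabs_sum _ _ _) _.
apply: (@le_trans _ _ (\sum_(i < n) A * K * D ^+ n * e * e ^+ i)).
  apply: ler_sum => i _; rewrite cabsM.
  have ni : (n - i.+1 < n)%N by rewrite ltn_subrL//= (leq_trans _ (ltn_ord i)).
  apply: (@le_trans _ _ (A * B ^+ i.+1 * (K * D ^+ (n - i.+1)))).
    by apply: ler_pM; rewrite ?cabs_ge0// IH.
  have -> : D ^+ n = D ^+ i.+1 * D ^+ (n - i.+1) by rewrite -exprD subnKC.
  rewrite BD exprMn [e ^+ i.+1]exprS.
  by rewrite le_eqVlt; apply/orP; left; apply/eqP; ring.
rewrite -mulr_sumr.
apply: (@le_trans _ _ (A * K * D ^+ n * e * 2)).
  rewrite ler_wpM2l ?mulr_ge0 ?exprn_ge0 ?(ltW A0) ?(ltW K0) ?(ltW D0) ?(ltW e0)//.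
  apply: le_trans (geometric_sum_le _ _) _; first by apply/andP; split; lra.
  by rewrite invf_ple ?posrE//; lra.
have -> : A * K * D ^+ n * e * 2 = D ^+ n * (K / 2 * (e * (4 * A))) by field.
rewrite [leRHS]mulrC ler_wpM2l ?exprn_ge0 ?(ltW D0)//.
apply: (@le_trans _ _ (K / 2 * cabs (b 0%N))).
  by rewrite ler_wpM2l// ltW// divr_gt0.
by rewrite mulrAC KE; lra.
Qed.

Lemma psum_coef_bound2 a b (r : R) f h : 0 < r -> psum a r f -> psum b r h ->
  exists A B : R, [/\ 0 < A, 0 < B, forall n, cabs (a n) <= A * B ^+ n &
    forall n, cabs (b n) <= A * B ^+ n].
Proof.
move=> r0 ha hb; have hr : 0 < r / 2 < r by apply/andP; split; lra.
have [A A0 hA] := psum_coef_bound ha hr.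
have [A' A'0 hA'] := psum_coef_bound hb hr.
have B0 n : 0 <= (r / 2)^-1 ^+ n by rewrite exprn_ge0// invr_ge0 divr_ge0 ?ltW.
exists (A + A'), (r / 2)^-1; split => [||n|n].
- exact: addr_gt0.
- by rewrite invr_gt0 divr_gt0.
- by apply: le_trans (hA n) _; rewrite ler_wpM2r// lerDl ltW.
- by apply: le_trans (hA' n) _; rewrite ler_wpM2r// lerDr ltW.
Qed.

(** Convergence of the quotient is part of the conclusion: by [mertens], the
    partial sums of s, multiplied by those of b, approach those of t. *)
Lemma psum_quotient b s t (r : R) f h : 0 < r -> b 0%N != 0 ->
  psum b r f -> psum t r h -> (forall n, cprod b s n = t n) ->
  exists2 d : R, 0 < d & psum s d (fun z => h z / f z).
Proof.
move=> r0 b0 hf hh hs.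
have [A [B [A0 B0 hb ht]]] := psum_coef_bound2 r0 hf hh.
have [K [D [K0 BD hK]]] := cprod_quotient_bound A0 B0 b0 hb ht hs.
have D0 : 0 < D := lt_le_trans B0 BD.
have [e e0 he] := psum_neq0 r0 hf b0.
exists (Num.min (Num.min r e) (4 * D)^-1).
  by rewrite !lt_min r0 e0 invr_gt0 mulr_gt0.
move=> z; rewrite !lt_min => /andP[/andP[zr ze]].
rewrite -[X in _ < X -> _]mul1r ltr_pdivlMr ?mulr_gt0// => zD.
have zD' : D * cabs z <= (2^-1) ^+ 2.
  by rewrite exprVn -[leRHS]mul1r ler_pdivlMr ?exprn_gt0//; lra.
have bnd c L E : 0 < L -> 0 < E -> E <= D -> (forall n, cabs (c n) <= L * E ^+ n) ->
    forall n, cabs (c n * z ^+ n) <= (A + K + L) * (2^-1 ^+ 2) ^+ n.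
  move=> L0 E0 ED hc n; rewrite cabsM cabsX.
  apply: (@le_trans _ _ (L * (E * cabs z) ^+ n)).
    by rewrite exprMn mulrA ler_wpM2r ?exprn_ge0 ?cabs_ge0.
  apply: ler_pM; rewrite ?exprn_ge0 ?mulr_ge0 ?cabs_ge0 ?(ltW L0) ?(ltW E0)//.
    by rewrite lerDr addr_ge0 ?ltW.
  apply: lerXn2r; rewrite ?nnegrE ?mulr_ge0 ?cabs_ge0 ?(ltW E0)//.
  by apply: le_trans zD'; rewrite ler_wpM2r ?cabs_ge0.
have hb' := bnd b A B A0 B0 BD hb.
have hs' := bnd s K D K0 D0 (lexx _) hK.
have [L [L0 hbL hsL]] : exists L : R, [/\ 0 < L,
    forall n, cabs (b n * z ^+ n) <= L * (2^-1 ^+ 2) ^+ n &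
    forall n, cabs (s n * z ^+ n) <= L * (2^-1 ^+ 2) ^+ n].
  exists (A + K + A + K); split => [|n|n]; first by rewrite !addr_gt0.
    apply: le_trans (hb' n) _; rewrite ler_wpM2r ?exprn_ge0// lerDl ltW//.
  by apply: le_trans (hs' n) _; rewrite ler_wpM2r ?exprn_ge0//; lra.
have h2 : 0 <= (2^-1 : R) < 1 by apply/andP; split; lra.
have := mertens (ltW L0) h2 hbL hsL.
rewrite (_ : cprod _ _ = fun n => t n * z ^+ n); last first.
  by apply/funext => n; rewrite cprod_scale hs.
set Bz := series _; set Sz := series _; set Tz := series _ => hm.
have hT : Tz @ \oo --> h z := hh z zr.
have hB : Bz @ \oo --> f z := hf z zr.
have fz0 := he z ze.
have : (fun n => (Bz n * Sz n - Tz n + Tz n) / Bz n) @ \oo --> (0 + h z) / f z.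
  by apply: cvgM; [exact: cvgD hm hT|exact: cvgV].
rewrite add0r; apply: cvg_trans; apply: near_eq_cvg.
near=> n; have Bn0 : Bz n != 0.
  by near: n; exact: (cvgr_neq0 _ hB).
by rewrite subrK mulrAC divff// mul1r.
Unshelve. all: by end_near.
Qed.

Lemma psum_quotient_simple_zero b s t (r : R) f h : 0 < r ->
  b 0%N = 0 -> b 1%N != 0 ->
  psum b r f -> psum t r h -> (forall n, cprod b s n = t n) ->
  exists2 d : R, 0 < d &
    forall z, z != 0 -> cabs z < d -> sums_to s z (h z / f z).
Proof.
move=> r0 b0 b1 hf hh hs.
have t0 : t 0%N = 0 by rewrite -hs /cprod big_ord1 b0 mul0r.
have [f1 hf1 fE] := psum_tail hf.
have [h1 hh1 hE] := psum_tail hh.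
have hs1 n : cprod (fun n => b n.+1) s n = t n.+1.
  rewrite -hs /cprod [in RHS]big_ord_recl b0 mul0r add0r.
  by apply: eq_bigr => i _; rewrite lift0 subSS.
have [d d0 hd] := psum_quotient r0 b1 hf1 hh1 hs1.
exists (Num.min d r) => [|z z0]; first by rewrite lt_min d0.
rewrite lt_min => /andP[zd zr].
by rewrite fE// hE// t0 b0 !add0r -mulf_div divff// mul1r; exact: hd.
Qed.

(** The linear term dominates: on a small disc the remaining terms have a
    Lipschitz constant at most half the modulus of the linear coefficient. *)
Lemma psum_injective a (r : R) f : 0 < r -> psum a r f -> a 1%N != 0 ->
  exists2 d : R, 0 < d &
    forall z w, cabs z < d -> cabs w < d -> f z = f w -> z = w.
Proof.
move=> r0 ha a1; have hr : 0 < r / 2 < r by apply/andP; split; lra.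
have [A A0 hA] := psum_coef_bound ha hr.
set B := (r / 2)^-1 in hA; have B0 : 0 < B by rewrite invr_gt0 divr_gt0.
clearbody B.
have c0 : 0 < cabs (a 1%N) by rewrite cabs_gt0.
(* the factor n in the Lipschitz constant of z ^+ n is absorbed in 2 ^+ n,
   whence the ratio 2 * B * d in the sum below *)
pose d := Num.min (Num.min r (4 * B)^-1) (cabs (a 1%N) / (8 * A * B ^+ 2)).
have d0 : 0 < d.
  by rewrite !lt_min r0 invr_gt0 divr_gt0// !mulr_gt0// ?exprn_gt0.
have dr : d <= r by rewrite !ge_min lexx.
have dB : 2 * B * d <= 2^-1.
  have : d <= (4 * B)^-1 by rewrite !ge_min lexx orbT.
  by rewrite -[X in _ <= X]mul1r ler_pdivlMr ?mulr_gt0//; lra.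
have dA : d * (8 * A * B ^+ 2) <= cabs (a 1%N).
  by rewrite -ler_pdivlMr ?ge_min ?lexx ?orbT// !mulr_gt0// ?exprn_gt0.
exists d => // z w zd wd fzw; apply/eqP; rewrite -subr_eq0 -cabs_eq0.
have hz := ha z (lt_le_trans zd dr); have hw := ha w (lt_le_trans wd dr).
have hzw : (fun n => series (fun n => a n * z ^+ n) n -
    series (fun n => a n * w ^+ n) n) @ \oo --> (0 : C).
  have <- : f z - f w = 0 by rewrite fzw subrr.
  exact: (cvgB hz hw).
have key : cabs (0 - a 1%N * (z - w)) <= cabs (z - w) * (cabs (a 1%N) / 2).
  apply: (@cabs_lim_le _ _ _ _ _ 2%N hzw) => -[//|[//|M]] _.
  rewrite /series /= -sumrB !big_nat_recl//= big_mkord !expr0 mulr1 !expr1 subrr.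
  rewrite add0r -mulrBr addrC addKr.
  apply: le_trans (cabs_sum _ _ _) _.
  apply: (@le_trans _ _ (\sum_(i < M)
      cabs (z - w) * (A * B * (2 * B * d)) * 2^-1 ^+ i)).
    apply: ler_sum => i _; rewrite -mulrBr cabsM subrXX cabsM.
    have hpow : cabs (\sum_(j < i.+2) z ^+ (i.+2.-1 - j) * w ^+ j) <=
        (2 * d) ^+ i.+1.
      apply: le_trans (cabs_sum _ _ _) _.
      apply: (@le_trans _ _ (\sum_(j < i.+2) d ^+ i.+1)).
        apply: ler_sum => j _; rewrite cabsM !cabsX.
        have -> : d ^+ i.+1 = d ^+ (i.+2.-1 - j) * d ^+ j.
          by rewrite -exprD subnK// -ltnS.
        by apply: ler_pM; rewrite ?exprn_ge0 ?cabs_ge0//; apply: lerXn2r;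
          rewrite ?nnegrE ?cabs_ge0 ?(ltW zd) ?(ltW wd) ?(ltW d0).
      rewrite sumr_const card_ord -[leLHS]mulr_natl exprMn.
      rewrite ler_wpM2r ?exprn_ge0 ?(ltW d0)//.
      by rewrite -natrX ler_nat ltn_expl.
    apply: (@le_trans _ _ (A * B ^+ i.+2 * (cabs (z - w) * (2 * d) ^+ i.+1))).
      by apply: ler_pM; rewrite ?mulr_ge0 ?cabs_ge0// ler_wpM2l ?cabs_ge0.
    have -> : A * B ^+ i.+2 * (cabs (z - w) * (2 * d) ^+ i.+1) =
       cabs (z - w) * (A * B * (2 * B * d)) * (2 * B * d) ^+ i.
      by rewrite !exprS !exprMn; ring.
    rewrite ler_wpM2l ?mulr_ge0 ?cabs_ge0 ?(ltW A0) ?(ltW B0) ?(ltW d0)//.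
    by apply: lerXn2r; rewrite ?nnegrE ?invr_ge0 ?mulr_ge0 ?(ltW B0) ?(ltW d0).
  rewrite -mulr_sumr -mulrA ler_wpM2l ?cabs_ge0//.
  apply: (@le_trans _ _ (A * B * (2 * B * d) * 2)).
    rewrite ler_wpM2l ?mulr_ge0 ?(ltW A0) ?(ltW B0) ?(ltW d0)//.
    apply: le_trans (geometric_sum_le _ _) _; first by apply/andP; split; lra.
    by rewrite invf_ple ?posrE//; lra.
  by lra.
move: key; rewrite sub0r cabsN cabsM [leRHS]mulrC => h.
have := cabs_ge0 (z - w); rewrite le_eqVlt => /predU1P[<-//|zw].
by exfalso; move: h; rewrite leNgt => /negP; apply; rewrite ltr_pM2r//; lra.
Qed.

Lemma analytic_derive1_neq0 a (r : R) f : 0 < r -> psum a r f ->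
  derive1 f 0 != 0 -> a 1%N != 0.
Proof.
move=> r0 ha; apply: contra_neq => a1.
have [f1 h1 fE] := psum_tail ha; have [f2 h2 f1E] := psum_tail h1.
have [K K0 [e e0 hK]] := psum_bounded r0 h2.
rewrite /derive1; apply: cvg_lim => //.
apply/cvgrPdist_lt => eps eps0.
have epsE : toC (cabs eps) = eps by rewrite toC_cabs ger0_norm// ltW.
have c0 : 0 < cabs eps by rewrite -ltr_toC epsE.
apply/dnear0P; exists (Num.min (Num.min r e) (cabs eps / K)).
  by rewrite !lt_min r0 e0 divr_gt0.
move=> z z0; rewrite !lt_min => /andP[/andP[zr ze]]; rewrite ltr_pdivlMr// => zK.
rewrite sub0r normrN addr0 (psum0E r0 ha) fE// f1E// a1 add0r [a 0%N + _]addrC addrK.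
rewrite (_ : _ *: _ = z * f2 z); last exact: (mulKf z0).
rewrite -toC_cabs -epsE ltr_toC cabsM; apply: le_lt_trans zK.
by rewrite ler_wpM2l ?cabs_ge0// hK.
Qed.

End Division.

(** * Linear functionals on polynomials given by their moments *)

Section MomentFunctional.
Variable R : realType.
Local Notation C := (Cplx R).
Implicit Types (m : nat -> C) (p q : {poly C}).

Definition momf m p : C := \sum_(k < size p) p`_k * m k.

Lemma momf_wide N m p : (size p <= N)%N -> momf m p = \sum_(k < N) p`_k * m k.
Proof.
move=> pN; rewrite /momf (big_ord_widen N (fun k => p`_k * m k) pN).
rewrite [RHS](bigID (fun k : 'I_N => (k < size p)%N)) /=.
rewrite [X in _ + X]big1 ?addr0// => i; rewrite -leqNgt => pi.
by rewrite nth_default// mul0r.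
Qed.

Lemma momfD m p q : momf m (p + q) = momf m p + momf m q.
Proof.
pose N := maxn (size p) (size q).
rewrite !(@momf_wide N) ?leq_maxl ?leq_maxr ?size_polyD// -big_split /=.
by apply: eq_bigr => i _; rewrite coefD mulrDl.
Qed.

Lemma momfZ m c p : momf m (c *: p) = c * momf m p.
Proof.
rewrite !(@momf_wide (size p)) ?size_scale_leq// mulr_sumr.
by apply: eq_bigr => i _; rewrite coefZ mulrA.
Qed.

Lemma momfB m p q : momf m (p - q) = momf m p - momf m q.
Proof. by rewrite -scaleN1r momfD momfZ mulN1r. Qed.

Lemma momf0 m : momf m 0 = 0.
Proof. by rewrite /momf size_poly0 big_ord0. Qed.

Lemma momf_sum m I (r : seq I) (F : I -> {poly C}) :
  momf m (\sum_(i <- r) F i) = \sum_(i <- r) momf m (F i).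
Proof. exact: (big_morph _ (momfD m) (momf0 m)). Qed.

Lemma momfC m c : momf m c%:P = c * m 0%N.
Proof. by rewrite (@momf_wide 1) ?size_polyC_leq1// big_ord1 coefC. Qed.

Lemma momf_mulX m p : momf m ('X * p) = momf (fun k => m k.+1) p.
Proof.
rewrite (@momf_wide (size p).+1).
  by rewrite big_ord_recl coefXM mul0r add0r; apply: eq_bigr => i _; rewrite coefXM.
by have := size_polyMleq 'X p; rewrite size_polyX.
Qed.

Lemma momf_lin a b m m' p :
  momf (fun k => a * m k + b * m' k) p = a * momf m p + b * momf m' p.
Proof.
rewrite /momf !mulr_sumr -big_split; apply: eq_bigr => i _ /=.
by rewrite mulrDr mulrCA [p`_i * (b * _)]mulrCA.
Qed.

Lemma momf_map_conj m p : (forall k, (m k)^* = m k) ->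
  momf m (map_poly Num.conj p) = (momf m p)^*.
Proof.
move=> mr; rewrite /momf size_map_poly rmorph_sum; apply: eq_bigr => i _.
by rewrite coef_map rmorphM /= mr.
Qed.

End MomentFunctional.

(** * Bilinear and Hermitian orthogonality *)

Section Orthogonality.
Variable R : realType.
Local Notation C := (Cplx R).
Implicit Types (m : nat -> C) (p q : {poly C}) (Q : nat -> {poly C}).

(** Since Q_k has degree k, the polynomials of degree less than n are spanned
    by the Q_k with k < n. *)
Lemma momf_orthogonal_lower m Q q n :
  (forall k, size (Q k) = k.+1) ->
  (forall k, (k < n)%N -> momf m (Q k * q) = 0) ->
  forall p, (size p <= n)%N -> momf m (p * q) = 0.
Proof.
move=> szQ h; elim: {-2}n (leqnn n) => [|N IH] Nn p.
  by rewrite leqn0 size_poly_eq0 => /eqP ->; rewrite mul0r momf0.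
move=> pN; pose c := p`_N / lead_coef (Q N).
have lQ : lead_coef (Q N) != 0 by rewrite lead_coef_eq0 -size_poly_eq0 szQ.
have : (size (p - c *: Q N)%R <= N)%N.
  apply/leq_sizeP => j; rewrite leq_eqVlt => /predU1P[<-|Nj].
    rewrite coefB coefZ /c; have -> : (Q N)`_N = lead_coef (Q N).
      by rewrite lead_coefE szQ.
    by rewrite divfK// subrr.
  rewrite coefB coefZ !nth_default ?mulr0 ?subrr// ?szQ//.
  exact: leq_trans pN Nj.
move=> /(IH (ltnW Nn)); rewrite mulrBl momfB -scalerAl momfZ h// mulr0 subr0.
exact.
Qed.

(** Both conditions say that Q_n is orthogonal to all polynomials of smaller
    degree, a space that is stable under conjugation of the coefficients. *)
Lemma momf_orthogonal_conj m Q : (forall k, (m k)^* = m k) ->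
  (forall n, size (Q n) = n.+1) ->
  (forall i j, i != j -> momf m (Q i * map_poly Num.conj (Q j)) = 0) <->
  (forall i j, i != j -> momf m (Q i * Q j) = 0).
Proof.
move=> mr szQ.
have szc q : size (map_poly Num.conj q) = size q by exact: size_map_poly.
have cc q : map_poly Num.conj (map_poly Num.conj q) = q.
  by apply/polyP => i; rewrite !coef_map /= conjCK.
have c0 p q : momf m (map_poly Num.conj p * q) = 0 ->
    momf m (p * map_poly Num.conj q) = 0.
  move=> h; apply/eqP; rewrite -conjC_eq0 -momf_map_conj// rmorphM /= cc.
  by rewrite h.
split=> h i j.
  wlog ij : i j / (i < j)%N.
    move=> w; rewrite neq_ltn => /orP[ij|ij]; first by apply: w => //; rewrite ltn_eqF.
    by rewrite mulrC; apply: w => //; rewrite ltn_eqF.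
  move=> _; rewrite -[Q j]cc; apply: c0.
  apply: (@momf_orthogonal_lower m Q _ j) => // [k kj|].
    by apply: h; rewrite ltn_eqF.
  by rewrite szc szQ.
rewrite neq_ltn => /orP[ij|ij].
  apply: c0; apply: (@momf_orthogonal_lower m Q _ j) => // [k kj|].
    by apply: h; rewrite ltn_eqF.
  by rewrite szc szQ.
rewrite mulrC; apply: (@momf_orthogonal_lower m Q _ i) => // [k ki|].
  by apply: h; rewrite ltn_eqF.
by rewrite szc szQ.
Qed.

Lemma poly_toC_eq0 p : (forall x : R, p.[toC x] = 0) -> p = 0.
Proof.
move=> h; apply/eqP; apply: contraT => p0.
pose s := [seq (i%:R : C) | i <- iota 0 (size p)].
have : (size s < size p)%N.
  apply: max_poly_roots => //.
    by apply/allP => _ /mapP[i _ ->]; rewrite /root -toC_nat h.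
  by rewrite map_inj_uniq ?iota_uniq// => i j /eqP; rewrite eqr_nat => /eqP.
by rewrite size_map size_iota ltnn.
Qed.

End Orthogonality.

(** * The polynomials generated by kappa(z) / (1 - rho(z) x) *)

Section GeneratedPolynomials.
Variable R : realType.
Local Notation C := (Cplx R).
Variables rho kap : nat -> C.
Hypothesis rho0 : rho 0%N = 0.

(** The expansion of kappa(z) rho(z)^k in powers of z, that is, the coefficient
    of x^k in kappa(z) / (1 - rho(z) x). *)
Definition gcoef (k : nat) : nat -> C := iter k (cprod rho) kap.

Definition gpoly (n : nat) : {poly C} := \poly_(k < n.+1) gcoef k n.

Lemma gcoef_small k n : (n < k)%N -> gcoef k n = 0.
Proof.
elim: k n => [//|k IH] n nk /=; rewrite /cprod big1// => -[[|i] /= ni] _.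
  by rewrite rho0 mul0r.
rewrite IH ?mulr0// -ltnS; apply: leq_trans nk.
by rewrite ltnS subnSK// leq_subr.
Qed.

Lemma gcoef_diag n : gcoef n n = kap 0%N * rho 1%N ^+ n.
Proof.
elim: n => [|n IH]; first by rewrite expr0 mulr1.
rewrite -[gcoef _]/(cprod rho (gcoef n)) /cprod !big_ord_recl rho0 mul0r add0r.
rewrite big1 => [|i _].
  by rewrite addr0 lift0 subn1 IH exprSr mulrCA [rho _ * _]mulrC.
by rewrite gcoef_small ?mulr0// !lift0 subSS subnSK ?leq_subr.
Qed.

Lemma coef_gpoly n k : (gpoly n)`_k = gcoef k n.
Proof.
rewrite coef_poly; case: ltnP => // nk; by rewrite gcoef_small.
Qed.

Lemma size_gpoly n : kap 0%N != 0 -> rho 1%N != 0 -> size (gpoly n) = n.+1.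
Proof.
by move=> k0 r1; rewrite size_poly_eq// gcoef_diag mulf_neq0// expf_neq0.
Qed.

(** The equation rho(z) x Psi = Psi - kappa(z) for Psi = kappa(z) / (1 - rho(z)
    x), read coefficientwise in z. *)
Lemma gpoly_rec n :
  \sum_(i < n.+1) rho i *: ('X * gpoly (n - i)) = gpoly n - (kap n)%:P.
Proof.
apply/polyP => -[|k]; rewrite coef_sum coefB coefC coef_gpoly /=.
  by rewrite subrr big1// => i _; rewrite coefZ coefXM mulr0.
rewrite subr0; apply: eq_bigr => i _.
by rewrite coefZ coefXM /= coef_gpoly.
Qed.

Lemma momf_gpoly_rec m p n :
  cprod rho (fun n => momf m ('X * p * gpoly n)) n =
  momf m (p * gpoly n) - kap n * momf m p.
Proof.
have -> : kap n * momf m p = momf m (p * (kap n)%:P) by rewrite [p * _]mulrC mul_polyC momfZ.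
rewrite -momfB -mulrBr -gpoly_rec mulr_sumr momf_sum; apply: eq_bigr => i _.
by rewrite -scalerAr momfZ mulrA [p * 'X]mulrC.
Qed.

Lemma gpoly_horner_rec x n :
  cprod (fun i => 1 *+ (i == 0%N) - x * rho i) (fun n => (gpoly n).[x]) n =
  kap n.
Proof.
have h : \sum_(i < n.+1) (x * rho i) * (gpoly (n - i)).[x] = (gpoly n).[x] - kap n.
  have := congr1 (horner^~ x) (gpoly_rec n); rewrite hornerD hornerN hornerC => <-.
  rewrite horner_sum; apply: eq_bigr => i _.
  by rewrite hornerZ hornerM hornerX mulrCA mulrA.
have h0 : \sum_(i < n.+1) (1 *+ (i == 0%N :> nat)) * (gpoly (n - i)).[x] = (gpoly n).[x].
  rewrite big_ord_recl subn0 mul1r big1 ?addr0// => i _.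
  by rewrite lift0 mul0r.
by rewrite /cprod (eq_bigr _ (fun i _ => mulrBl _ _ _)) sumrB h h0 subKr.
Qed.

End GeneratedPolynomials.

(** * Integrals of complex functions *)

Section ComplexIntegral.
Variable R : realType.
Local Notation C := (Cplx R).
Variable mu : probability (measurableTypeR R) R.
Implicit Types (f h : R -> C) (p : {poly C}) (z w c : C).

Lemma Re_add z w : complex.Re (z + w) = complex.Re z + complex.Re w.
Proof. by case: z w => [a b] [a' b']. Qed.
Lemma Im_add z w : complex.Im (z + w) = complex.Im z + complex.Im w.
Proof. by case: z w => [a b] [a' b']. Qed.
Lemma Re_mul z w : complex.Re (z * w) =
  complex.Re z * complex.Re w - complex.Im z * complex.Im w.
Proof. by case: z w => [a b] [a' b']. Qed.
Lemma Im_mul z w : complex.Im (z * w) =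
  complex.Re z * complex.Im w + complex.Im z * complex.Re w.
Proof. by case: z w => [a b] [a' b']. Qed.
Lemma cplxP z w : complex.Re z = complex.Re w -> complex.Im z = complex.Im w ->
  z = w.
Proof. by case: z w => [a b] [a' b'] /= -> ->. Qed.

Lemma cabs_sqr z : cabs z ^+ 2 = complex.Re z ^+ 2 + complex.Im z ^+ 2.
Proof.
rewrite /cabs -[`|z|]/(`|(z : R[i])|) normc_def /= sqr_sqrtr//.
by rewrite addr_ge0 ?sqr_ge0.
Qed.

Lemma Re_le_cabs z : `|complex.Re z| <= cabs z.
Proof.
rewrite -(@ler_pXn2r _ 2) ?nnegrE ?cabs_ge0// cabs_sqr real_normK ?num_real//.
by rewrite lerDl sqr_ge0.
Qed.

Lemma Im_le_cabs z : `|complex.Im z| <= cabs z.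
Proof.
rewrite -(@ler_pXn2r _ 2) ?nnegrE ?cabs_ge0// cabs_sqr real_normK ?num_real//.
by rewrite lerDr sqr_ge0.
Qed.

Lemma cabs_le_ReIm z : cabs z <= `|complex.Re z| + `|complex.Im z|.
Proof.
rewrite -(@ler_pXn2r _ 2) ?nnegrE ?cabs_ge0 ?addr_ge0//.
rewrite cabs_sqr sqrrD !real_normK ?num_real// addrAC lerDl.
by rewrite mulrn_wge0// mulr_ge0.
Qed.

Definition cintegrable f :=
  mu.-integrable [set: measurableTypeR R]
    (fun x : R => (complex.Re (f x))%:E) /\
  mu.-integrable [set: measurableTypeR R]
    (fun x : R => (complex.Im (f x))%:E).

Lemma cintegrableD f h : cintegrable f -> cintegrable h ->
  cintegrable (fun x => f x + h x).
Proof.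
move=> [f1 f2] [h1 h2]; split.
  have := integrableD measurableT f1 h1; congr integrable.
  by apply/funext => x; rewrite /= Re_add EFinD.
have := integrableD measurableT f2 h2; congr integrable.
by apply/funext => x; rewrite /= Im_add EFinD.
Qed.

Lemma cintegralD f h : cintegrable f -> cintegrable h ->
  cintegral mu (fun x => f x + h x) = cintegral mu f + cintegral mu h.
Proof.
move=> [f1 f2] [h1 h2]; rewrite /cintegral; apply: cplxP; rewrite ?Re_add ?Im_add /=.
  rewrite -RintegralD//; congr Rintegral.
  by apply/funext => x; rewrite Re_add.
rewrite -RintegralD//; congr Rintegral.
by apply/funext => x; rewrite Im_add.
Qed.

Lemma cintegrable_scale c (u : R -> R) :
  mu.-integrable [set: measurableTypeR R] (fun x : R => (u x)%:E) ->
  cintegrable (fun x => c * toC (u x)).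
Proof.
move=> ui; split.
  have := integrableZl measurableT (complex.Re c) ui; congr integrable.
  by apply/funext => x; rewrite Re_mul /= mulr0 subr0 EFinM.
have := integrableZl measurableT (complex.Im c) ui; congr integrable.
by apply/funext => x; rewrite Im_mul /= mulr0 add0r EFinM.
Qed.

Lemma cintegral_scale c (u : R -> R) :
  mu.-integrable [set: measurableTypeR R] (fun x : R => (u x)%:E) ->
  cintegral mu (fun x => c * toC (u x)) = c * toC (\int[mu]_x u x).
Proof.
move=> ui; rewrite /cintegral; apply: cplxP.
  rewrite Re_mul /= mulr0 subr0 -RintegralZl//; congr Rintegral.
  by apply/funext => x; rewrite Re_mul /= mulr0 subr0.
rewrite Im_mul /= mulr0 add0r -RintegralZl//; congr Rintegral.
by apply/funext => x; rewrite Im_mul /= mulr0 add0r.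
Qed.

Lemma cabs_cintegral_le f (u : R -> R) : cintegrable f ->
  mu.-integrable [set: measurableTypeR R] (fun x : R => (u x)%:E) ->
  (forall x, cabs (f x) <= u x) -> cabs (cintegral mu f) <= 2 * \int[mu]_x u x.
Proof.
move=> [f1 f2] ui fu; apply: le_trans (cabs_le_ReIm _) _.
rewrite mulr_natl mulr2n; apply: lerD => /=.
  apply: le_trans (le_normr_Rintegral _ _) _ => //; apply: le_Rintegral => //.
    exact: (integrable_norm f1).
  by move=> x _; apply: le_trans (Re_le_cabs _) (fu x).
apply: le_trans (le_normr_Rintegral _ _) _ => //; apply: le_Rintegral => //.
  exact: (integrable_norm f2).
by move=> x _; apply: le_trans (Im_le_cabs _) (fu x).
Qed.

Lemma cintegrable_dominated f (u : R -> R) :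
  measurable_fun [set: measurableTypeR R] (fun x : R => complex.Re (f x)) ->
  measurable_fun [set: measurableTypeR R] (fun x : R => complex.Im (f x)) ->
  mu.-integrable [set: measurableTypeR R] (fun x : R => (u x)%:E) ->
  (forall x, cabs (f x) <= u x) -> cintegrable f.
Proof.
move=> m1 m2 ui fu; split.
  apply: (le_integrable measurableT _ _ ui); first exact/measurable_EFinP.
  move=> x _ /=; rewrite lee_fin.
  by apply: le_trans (Re_le_cabs _) (le_trans (fu x) (ler_norm _)).
apply: (le_integrable measurableT _ _ ui); first exact/measurable_EFinP.
move=> x _ /=; rewrite lee_fin.
by apply: le_trans (Im_le_cabs _) (le_trans (fu x) (ler_norm _)).
Qed.

End ComplexIntegral.

(** * Asymptotic expansion of the Cauchy-Stieltjes transform *)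

Section Moments.
Variable R : realType.
Local Notation C := (Cplx R).
Variable mu : probability (measurableTypeR R) R.
Hypothesis mu_moments : forall n : nat,
  mu.-integrable [set: measurableTypeR R] (fun x : R => (x ^+ n)%:E).
Implicit Types (p : {poly C}) (z w c : C).

Definition moment n : C := toC (\int[mu]_x (x ^+ n)).

Lemma moment_poly p :
  cintegrable mu (fun x => p.[toC x]) /\
  cintegral mu (fun x => p.[toC x]) = momf moment p.
Proof.
have -> : (fun x => p.[toC x]) =
    (fun x => \sum_(k < size p) p`_k * toC (x ^+ k)).
  by apply/funext => x; rewrite horner_coef; apply: eq_bigr => k _; rewrite toCX.
rewrite /momf; elim: (size p) => [|n [IH1 IH2]].
  have h0 : (fun x : R => \sum_(k < 0) p`_k * toC (x ^+ k)) =
      (fun x => 0 * toC (x ^+ 0)).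
    by apply/funext => x; rewrite big_ord0 mul0r.
  rewrite h0; split; first exact: cintegrable_scale.
  by rewrite cintegral_scale// mul0r big_ord0.
have hS : (fun x : R => \sum_(k < n.+1) p`_k * toC (x ^+ k)) =
   (fun x => \sum_(k < n) p`_k * toC (x ^+ k) + p`_n * toC (x ^+ n)).
  by apply/funext => x; rewrite big_ord_recr.
rewrite hS; split; first by apply: cintegrableD => //; exact: cintegrable_scale.
rewrite cintegralD//; last exact: cintegrable_scale.
by rewrite IH2 big_ord_recr cintegral_scale.
Qed.

(** The geometric series for 1 / (z - w) with its exact remainder. *)
Lemma resolvent_expansion N z w : z != 0 -> z != w ->
  (z - w)^-1 = \sum_(k < N) z^-1 ^+ k.+1 * w ^+ k +
     z^-1 ^+ N * (z - w)^-1 * w ^+ N.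
Proof.
move=> z0 zw; have zw0 : z - w != 0 by rewrite subr_eq0.
elim: N => [|N IH]; first by rewrite big_ord0 add0r !expr0 mul1r mulr1.
rewrite {1}IH big_ord_recr /= -addrA; congr (_ + _).
rewrite !exprSr; field; by rewrite zw0 z0.
Qed.

Lemma Im_resolvent_le z (x : R) : complex.Im z != 0 ->
  cabs ((z - toC x)^-1) <= `|complex.Im z|^-1.
Proof.
move=> bz; rewrite cabsV lef_pV2 ?posrE ?normr_gt0//.
  have := Im_le_cabs (z - toC x).
  by rewrite Im_add -[- toC x]/(Complex (- x) (- 0)) /= oppr0 addr0.
rewrite cabs_gt0 subr_eq0; apply: contra_neq bz => ->.
by [].
Qed.

Lemma measurable_resolvent z : complex.Im z != 0 ->
  measurable_fun [set: measurableTypeR R]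
    (fun x : R => complex.Re ((z - toC x)^-1)) /\
  measurable_fun [set: measurableTypeR R]
    (fun x : R => complex.Im ((z - toC x)^-1)).
Proof.
move=> b0; pose a := complex.Re z; pose b := complex.Im z.
(* measurability is that of an explicit continuous function *)
have E x : (z - toC x)^-1 = Complex ((a - x) / ((a - x) ^+ 2 + b ^+ 2))
    (- (b / ((a - x) ^+ 2 + b ^+ 2))).
  have -> : z - toC x = Complex (a - x) b.
    by apply: cplxP; rewrite ?Re_add ?Im_add /= ?oppr0 ?addr0.
  by [].
have d0 x : (a - x) ^+ 2 + b ^+ 2 != 0.
  by rewrite gt_eqF// ltr_wpDl ?sqr_ge0// exprn_even_gt0.
have cax : continuous (fun x : R => a - x).
  by move=> x; apply: cvgB; [exact: cvg_cst|exact: cvg_id].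
have cd : continuous (fun x : R => ((a - x) ^+ 2 + b ^+ 2)^-1).
  move=> x; apply: cvgV => //; apply: cvgD; last exact: cvg_cst.
  by apply: cvgM; exact: cax.
split.
  under eq_fun do rewrite E /=.
  by apply: continuous_measurable_fun => x; apply: cvgM; [exact: cax|exact: cd].
under eq_fun do rewrite E /=.
apply: continuous_measurable_fun => x; apply: cvgN.
by apply: cvgM; [exact: cvg_cst|exact: cd].
Qed.

(** Integrate [resolvent_expansion]: off the real axis the resolvent is at most
    1 / |Im z|, so the remainder is controlled by the absolute moment of order
    N. *)
Lemma cauchy_stieltjes_asymptotics N : exists2 K : R, 0 <= K &
  forall z : C, complex.Im z != 0 ->
  cabs (cauchy_stieltjes mu z - \sum_(k < N) z^-1 ^+ k.+1 * moment k) <=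
  K * cabs z^-1 ^+ N * `|complex.Im z|^-1.
Proof.
have ui := integrable_norm (mu_moments N).
exists (2 * \int[mu]_x `|x ^+ N|).
  by rewrite mulr_ge0// Rintegral_ge0.
move=> z bz.
have z0 : z != 0 by apply: contra_neq bz => ->.
have zx (x : R) : z != toC x by apply: contra_neq bz => ->.
pose q := \poly_(k < N) (z^-1 ^+ k.+1).
pose rem (x : R) := z^-1 ^+ N * (z - toC x)^-1 * toC x ^+ N.
have [q1 q2] := moment_poly q.
have qE : (fun x => (z - toC x)^-1) = (fun x => q.[toC x] + rem x).
  apply/funext => x; rewrite (resolvent_expansion N z0 (zx x)).
  by rewrite horner_poly.
have remle x : cabs (rem x) <= cabs z^-1 ^+ N * `|complex.Im z|^-1 * `|x ^+ N|.
  rewrite /rem -toCX !cabsM cabsX cabs_toC ler_wpM2r// ler_wpM2l ?exprn_ge0 ?cabs_ge0//.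
  exact: Im_resolvent_le.
have ui' := integrableZl measurableT (cabs z^-1 ^+ N * `|complex.Im z|^-1) ui.
have mrem (c : C) : measurable_fun [set: measurableTypeR R]
     (fun x : R => complex.Re (c * (z - toC x)^-1 * toC x ^+ N)) /\
    measurable_fun [set: measurableTypeR R]
     (fun x : R => complex.Im (c * (z - toC x)^-1 * toC x ^+ N)).
  have [m1 m2] := measurable_resolvent bz.
  have mX : measurable_fun [set: measurableTypeR R] (fun x : R => x ^+ N).
    by have /integrableP[/measurable_EFinP] := mu_moments N.
  split.
    rewrite (_ : (fun x => _) = (fun x : R => (complex.Re c * complex.Re (z - toC x)^-1
       - complex.Im c * complex.Im (z - toC x)^-1) * x ^+ N)); last first.
      by apply/funext => x; rewrite -toCX Re_mul Re_mul /= mulr0 subr0.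
    apply: measurable_funM => //; apply: measurable_funB;
      by apply: measurable_funM.
  rewrite (_ : (fun x => _) = (fun x : R => (complex.Re c * complex.Im (z - toC x)^-1
     + complex.Im c * complex.Re (z - toC x)^-1) * x ^+ N)); last first.
    by apply/funext => x; rewrite -toCX Im_mul Im_mul /= mulr0 add0r.
  apply: measurable_funM => //; apply: measurable_funD;
    by apply: measurable_funM.
have [mr1 mr2] := mrem (z^-1 ^+ N).
have remi : cintegrable mu rem := cintegrable_dominated mr1 mr2 ui' remle.
rewrite /cauchy_stieltjes qE cintegralD// q2.
have -> : momf moment q = \sum_(k < N) z^-1 ^+ k.+1 * moment k.
  rewrite (@momf_wide _ N) ?size_poly//; apply: eq_bigr => k _.
  by rewrite coef_poly ltn_ord.
rewrite addrC addKr; apply: le_trans (cabs_cintegral_le remi ui' remle) _.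
rewrite RintegralZl//.
by rewrite le_eqVlt; apply/orP; left; apply/eqP; ring.
Qed.

End Moments.

(** * Uniqueness of expansions and the identity principle *)

Section AnalyticOn.
Variable R : realType.
Local Notation C := (Cplx R).
Implicit Types (a b s t : nat -> C) (z w l c : C) (f h : C -> C) (r : R).

Lemma sums_to_single c k z : sums_to (fun n => c *+ (n == k)) z (c * z ^+ k).
Proof.
apply/cvg_cabsP; apply: (@cvg_trans _ ((fun=> 0 : R) @ \oo)); last exact: cvg_cst.
apply: near_eq_cvg; exists k.+1 => // n /= kn.
rewrite /series /= big_mkord (bigD1 (Ordinal kn)) //= eqxx mulr1n big1 ?addr0.
  by rewrite subrr cabs0.
by move=> i; rewrite -val_eqE /= => /negPf ->; rewrite mul0r.
Qed.

Lemma psum_fill a r f : (forall z, z != 0 -> cabs z < r -> sums_to a z (f z)) ->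
  psum a r (fun z => if z == 0 then a 0%N else f z).
Proof.
move=> h z zr; case: eqP => [->|/eqP z0]; last exact: h.
exact: (@sums_to_at0 _ a).
Qed.

Lemma sums_to_coef_unique a b r f : 0 < r ->
  (forall z, z != 0 -> cabs z < r -> sums_to a z (f z)) ->
  (forall z, z != 0 -> cabs z < r -> sums_to b z (f z)) -> a =1 b.
Proof.
move=> r0 ha hb n; apply/eqP; rewrite -subr_eq0; apply/eqP.
have hab : psum (fun n => a n + (-1) * b n) r
    (fun z => if z == 0 then a 0%N + (-1) * b 0%N else 0).
  apply: (@psum_fill _ r (fun=> 0)) => z z0 zr.
  have -> : 0 = f z + (-1) * f z by rewrite mulN1r subrr.
  by apply: sums_toD; [exact: ha|apply: sums_toZ; exact: hb].
rewrite -mulN1r; apply: (psum_near0_coef0 r0 hab) => /=.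
by apply/dnear0P; exists 1 => // z /negPf ->.
Qed.

Definition analytic_on r f := exists a, psum a r f.

Lemma analytic_on_cst r c : analytic_on r (fun=> c).
Proof.
exists (fun n => c *+ (n == 0%N)) => z _.
by have := @sums_to_single c 0%N z; rewrite expr0 mulr1.
Qed.

Lemma analytic_on_id r : analytic_on r (fun z => z).
Proof.
exists (fun n => 1 *+ (n == 1%N)) => z _.
by have := @sums_to_single 1 1%N z; rewrite mul1r expr1.
Qed.

Lemma analytic_onD r f h : analytic_on r f -> analytic_on r h ->
  analytic_on r (fun z => f z + h z).
Proof.
move=> [a ha] [b hb]; exists (fun n => a n + b n) => z zr.
by apply: sums_toD; [exact: ha|exact: hb].
Qed.

Lemma analytic_onM r f h : analytic_on r f -> analytic_on r h ->
  analytic_on r (fun z => f z * h z).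
Proof. by move=> [a ha] [b hb]; exists (cprod a b); exact: psumM. Qed.

Lemma analytic_onN r f : analytic_on r f -> analytic_on r (fun z => - f z).
Proof.
move=> hf; rewrite (_ : (fun z => _) = (fun z => -1 * f z)).
  exact: (analytic_onM (@analytic_on_cst r (-1)) hf).
by apply/funext => z; rewrite mulN1r.
Qed.

Lemma analytic_onX r f k : analytic_on r f -> analytic_on r (fun z => f z ^+ k).
Proof.
move=> hf; elim: k => [|k IH].
  rewrite (_ : (fun z => _) = fun=> 1); first exact: analytic_on_cst.
  by apply/funext => z; rewrite expr0.
rewrite (_ : (fun z => _) = (fun z => f z * f z ^+ k)); first exact: (analytic_onM hf IH).
by apply/funext => z; rewrite exprS.
Qed.

Lemma analytic_on_sum r N (F : 'I_N -> C -> C) :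
  (forall i, analytic_on r (F i)) ->
  analytic_on r (fun z => \sum_(i < N) F i z).
Proof.
elim: N F => [|N IH] F hF.
  rewrite (_ : (fun z => _) = fun=> 0); first exact: analytic_on_cst.
  by apply/funext => z; rewrite big_ord0.
rewrite (_ : (fun z => _) = (fun z => \sum_(i < N) F (widen_ord (leqnSn N) i) z
   + F ord_max z)); last by apply/funext => z; rewrite big_ord_recr.
exact: (analytic_onD (IH _ (fun i => hF _)) (hF _)).
Qed.

(** The disc of expansion is given beforehand, so the identity principle is the
    uniqueness of the coefficients, with no analytic continuation. *)
Lemma analytic_on_eq0 r f : 0 < r -> analytic_on r f ->
  (exists2 d : R, 0 < d & forall z, z != 0 -> cabs z < d -> f z = 0) ->
  forall z, cabs z < r -> f z = 0.
Proof.
move=> r0 [a ha] [d d0 hd] z zr.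
have a0 := psum_near0_coef0 r0 ha (proj2 (dnear0P _) (ex_intro2 _ _ d d0 hd)).
apply: (sums_to_unique (ha z zr)).
have := @sums_to_single 0 0%N z; rewrite mul0r; apply: sums_to_ext => n.
by rewrite a0 mul0rn.
Qed.

End AnalyticOn.

(** * The kernel E[psi(z,X) psi(v,X)] *)

Section ProductKernel.
Variable R : realType.
Local Notation C := (Cplx R).
Variables (rho g : C -> C) (ra ga ka m : nat -> C) (r : R).
Hypothesis r0 : 0 < r.
Hypothesis rho_psum : psum ra r rho.
Hypothesis g_psum : psum ga r g.
Hypothesis ra0 : ra 0%N = 0.
Hypothesis ra1 : ra 1%N != 0.
Hypothesis ka0 : ka 0%N != 0.
Hypothesis ka_sum : forall z, z != 0 -> cabs z < r ->
  sums_to ka z (rho z / g z).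
Hypothesis rho_neq0 : forall z, z != 0 -> cabs z < r -> rho z != 0.
Hypothesis g_neq0 : forall z, z != 0 -> cabs z < r -> g z != 0.
Hypothesis rho_inj : forall z w, cabs z < r -> cabs w < r ->
  rho z = rho w -> z = w.
Local Notation Q := (gpoly ra ka).
Hypothesis Q_mean : forall n, momf m (Q n) = 1 *+ (n == 0%N).

(** The closed form of E[psi(z,X) psi(v,X)]. *)
Definition gen_kernel z v : C :=
  ((g v)^-1 - (g z)^-1) / ((rho v)^-1 - (rho z)^-1).

(** The number E[X^k psi(v,X)]: multiplying psi by x amounts to dividing by
    rho(v) and subtracting 1 / g(v), and E[psi(v,X)] = 1. *)
Fixpoint kmom (v : C) (k : nat) : C :=
  if k is j.+1 then (rho v)^-1 * kmom v j + - (g v)^-1 * m j else 1.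

Local Notation ka_fun := (fun z => if z == 0 then ka 0%N else rho z / g z).

Lemma kmom_mulX v p : momf (kmom v) ('X * p) =
  (rho v)^-1 * momf (kmom v) p + - (g v)^-1 * momf m p.
Proof. by rewrite momf_mulX -momf_lin. Qed.


(** [gpoly_rec] seen through the functional with moments [kmom v]: the values
    on the Q_n expand the quotient of rho(z)/g(v) - rho(z)/g(z) by
    rho(z)/rho(v) - 1, which is the kernel. *)
Lemma kmom_gpoly_rec v n :
  cprod (fun i => (rho v)^-1 * ra i + (-1) *+ (i == 0%N))
    (fun n => momf (kmom v) (Q n)) n = (g v)^-1 * ra n - ka n.
Proof.
have h := momf_gpoly_rec ka ra0 (kmom v) 1 n.
have h1 : momf (kmom v) 1 = 1.
  by have := momfC (kmom v) 1; rewrite mul1r.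
have hX k : momf (kmom v) ('X * 1 * Q k) =
    (rho v)^-1 * momf (kmom v) (Q k) + - (g v)^-1 * 1 *+ (k == 0%N).
  by rewrite mulr1 kmom_mulX Q_mean mulrnAr.
have hsum : cprod ra (fun k => momf (kmom v) ('X * 1 * Q k)) n =
    (rho v)^-1 * cprod ra (fun k => momf (kmom v) (Q k)) n - (g v)^-1 * ra n.
  rewrite /cprod; under eq_bigr do rewrite hX mulrDr mulr1.
  rewrite big_split /= mulr_sumr; congr (_ + _).
    by apply: eq_bigr => i _; rewrite mulrCA.
  rewrite big_ord_recr /= subnn mulr1n big1 ?add0r => [|i _].
    by rewrite mulrC mulNr.
  by rewrite subn_eq0 leqNgt ltn_ord /= mulr0n mulr0.
rewrite hsum h1 [ka n * 1]mulr1 mul1r in h.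
rewrite /cprod; under eq_bigr do rewrite mulrDl.
rewrite big_split /=.
rewrite [X in _ + X]big_ord_recl subn0 mulr1n mulN1r.
rewrite [X in _ + (_ + X)]big1 ?addr0 => [|i _]; last by rewrite lift0 mul0r.
have -> : \sum_(i < n.+1) (rho v)^-1 * ra i * momf (kmom v) (Q (n - i)) =
    (rho v)^-1 * cprod ra (fun k => momf (kmom v) (Q k)) n.
  by rewrite /cprod mulr_sumr; apply: eq_bigr => i _; rewrite mulrA.
apply/eqP; rewrite subr_eq -addrA [_ + momf _ _]addrC -h addrCA subrr addr0.
by [].
Qed.

Lemma gen_kernel_expansion v : v != 0 -> cabs v < r ->
  exists2 d : R, 0 < d & forall z, z != 0 -> cabs z < d ->
    sums_to (fun n => momf (kmom v) (Q n)) z (gen_kernel z v).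
Proof.
move=> v0 vr.
have hka := psum_fill ka_sum.
have hb : psum (fun i => (rho v)^-1 * ra i + (-1) *+ (i == 0%N)) r
    (fun z => (rho v)^-1 * rho z + (-1)).
  move=> z zr; apply: sums_toD; first by apply: sums_toZ; exact: rho_psum.
  by have := @sums_to_single R (-1) 0%N z; rewrite expr0 mulr1.
have ht : psum (fun n => (g v)^-1 * ra n + (-1) * ka n) r
    (fun z => (g v)^-1 * rho z + (-1) * ka_fun z).
  by move=> z zr; apply: sums_toD; apply: sums_toZ; [exact: rho_psum|exact: hka].
have b0 : (rho v)^-1 * ra 0%N + (-1) *+ (0%N == 0%N) != 0 :> C.
  by rewrite ra0 mulr0 add0r oppr_eq0 oner_neq0.
have hs n : cprod (fun i => (rho v)^-1 * ra i + (-1) *+ (i == 0%N))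
    (fun n => momf (kmom v) (Q n)) n = (g v)^-1 * ra n + (-1) * ka n.
  by rewrite kmom_gpoly_rec mulN1r.
have [d d0 hd] := psum_quotient r0 b0 hb ht hs.
exists (Num.min d r) => [|z z0]; first by rewrite lt_min d0.
rewrite lt_min => /andP[zd zr].
have := hd z zd; rewrite (negPf z0) mulN1r.
suff -> : ((g v)^-1 * rho z - rho z / g z) / ((rho v)^-1 * rho z - 1) = gen_kernel z v.
  by [].
have rz := rho_neq0 z0 zr.
have -> : (g v)^-1 * rho z - rho z / g z = rho z * ((g v)^-1 - (g z)^-1).
  by rewrite mulrBr mulrC.
have -> : (rho v)^-1 * rho z - 1 = rho z * ((rho v)^-1 - (rho z)^-1).
  by rewrite mulrBr divff// mulrC.
by rewrite -mulf_div divff// mul1r.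
Qed.

(** By induction on p. Multiplying p by 'X turns the expansion into its
    quotient by rho, up to a multiple of kappa; since rho has a simple zero at
    the origin, the radius obtained depends on p. *)
Lemma kmom_expansion p :
  exists2 d : R, 0 < d & forall v, v != 0 -> cabs v < d ->
    sums_to (fun n => momf m (p * Q n)) v (momf (kmom v) p).
Proof.
elim/poly_ind: p => [|p c [d d0 hd]].
  exists 1 => // v _ _; rewrite momf0.
  have := @sums_to_single R 0 0%N v; rewrite mul0r; apply: sums_to_ext => n.
  by rewrite mul0r momf0 mul0rn.
pose e := Num.min d r.
have e0 : 0 < e by rewrite lt_min d0.
have hka := psum_fill ka_sum.
have ht : psum (fun n => momf m (p * Q n) + (- momf m p) * ka n) e
    (fun v => (if v == 0 then momf m (p * Q 0%N) else momf (kmom v) p)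
       + (- momf m p) * ka_fun v).
  move=> v; rewrite lt_min => /andP[vd vr].
  apply: sums_toD; last by apply: sums_toZ; exact: hka.
  by apply: (@psum_fill _ (fun n => momf m (p * Q n)) d (fun v => momf (kmom v) p)).
have hb : psum ra e rho.
  by move=> v; rewrite lt_min => /andP[_]; exact: rho_psum.
have hs n : cprod ra (fun n => momf m ('X * p * Q n)) n =
    momf m (p * Q n) + (- momf m p) * ka n.
  by rewrite momf_gpoly_rec// mulNr [ka n * _]mulrC.
have [d' d'0 hd'] := psum_quotient_simple_zero e0 ra0 ra1 hb ht hs.
exists (Num.min d' e) => [|v v0]; first by rewrite lt_min d'0.
rewrite lt_min => /andP[vd' ve].
have vr : cabs v < r by move: ve; rewrite lt_min => /andP[].
have -> : momf (kmom v) (p * 'X + c%:P) =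
    (momf (kmom v) p + - momf m p * (rho v / g v)) / rho v + c * v ^+ 0.
  rewrite momfD momfC mulrC kmom_mulX expr0 /=; congr (_ + _).
  by field; rewrite rho_neq0// g_neq0.
have := sums_toD (hd' v v0 vd') (@sums_to_single R c 0%N v).
rewrite (negPf v0); apply: sums_to_ext => n.
by rewrite mulrDl momfD mul_polyC momfZ Q_mean mulrnAr mulr1 [p * 'X]mulrC.
Qed.

(** The kernel is invariant under (z, v) -> (z/2, 2v). Comparing coefficients
    in z first, at a fixed v, and then in v, each L(Q_i Q_j) is equal to itself
    times 2^(j-i). *)
Lemma orthogonal_of_product_kernel (T : C -> C) (d : R) : 0 < d ->
  (forall z v, z != 0 -> v != 0 -> cabs z < d -> cabs v < d -> z != v ->
     gen_kernel z v = T (z * v)) ->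
  forall i j, i != j -> momf m (Q i * Q j) = 0.
Proof.
move=> d0 hT i j ij.
have two0 : (2 : C) != 0 by rewrite pnatr_eq0.
have c2 : cabs (2 : C) = 2 by rewrite -toC_nat cabs_toC ger0_norm.
have ch : cabs (2^-1 : C) = 2^-1 by rewrite cabsV c2.
have rescale v n : v != 0 -> cabs v < Num.min d r / 2 ->
    momf (kmom v) (Q n) = 2^-1 ^+ n * momf (kmom (2 * v)) (Q n).
  move=> v0 hv; have := hv; rewrite ltr_pdivlMr// lt_min => /andP[vd vr].
  have cv : 0 < cabs v by rewrite cabs_gt0.
  have v2 : 2 * v != 0 by rewrite mulf_neq0.
  have cv2 : cabs (2 * v) = cabs v * 2 by rewrite cabsM c2 mulrC.
  have vr1 : cabs v < r by lra.
  have [e1 e10 h1] := gen_kernel_expansion v0 vr1.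
  have v2r : cabs (2 * v) < r by rewrite cv2.
  have [e2 e20 h2] := gen_kernel_expansion v2 v2r.
  pose e := Num.min (Num.min e1 e2) (Num.min d (cabs v)).
  have e0 : 0 < e by rewrite !lt_min e10 e20 d0.
  apply: (@sums_to_coef_unique R (fun n => momf (kmom v) (Q n))
     (fun n => 2^-1 ^+ n * momf (kmom (2 * v)) (Q n)) e (fun z => gen_kernel z v) e0).
    by move=> z z0; rewrite !lt_min => /andP[/andP[ze1 _] _]; exact: h1.
  move=> z z0; rewrite !lt_min => /andP[/andP[_ ze2] /andP[zd zv]].
  have chz : cabs (2^-1 * z) = 2^-1 * cabs z by rewrite cabsM ch.
  have cz : 0 < cabs z by rewrite cabs_gt0.
  apply: sums_to_scale.
  have hz0 : 2^-1 * z != 0 by rewrite mulf_neq0// invr_eq0.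
  have -> : gen_kernel z v = gen_kernel (2^-1 * z) (2 * v).
    rewrite hT ?hT//; first by congr T; rewrite mulrACA mulVf// mul1r.
    - by rewrite chz; lra.
    - by rewrite cv2.
    - apply/eqP => /(congr1 (@cabs R)); rewrite chz cv2 => hh; lra.
    - by lra.
    - by apply/eqP => /(congr1 (@cabs R)) hh; lra.
  by apply: h2 => //; rewrite chz; lra.
have [e e0 he] := kmom_expansion (Q i).
pose s := Num.min (Num.min d r / 2) (e / 2).
have s0 : 0 < s by rewrite lt_min !divr_gt0// lt_min d0.
have h1 v : v != 0 -> cabs v < s ->
    sums_to (fun n => momf m (Q i * Q n)) v (momf (kmom v) (Q i)).
  move=> v0; rewrite lt_min => /andP[_ ve]; apply: he => //.
  by have := cabs_ge0 v; lra.
have h2 v : v != 0 -> cabs v < s ->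
    sums_to (fun n => 2^-1 ^+ i * (2 ^+ n * momf m (Q i * Q n))) v
      (momf (kmom v) (Q i)).
  move=> v0; rewrite lt_min => /andP[vd ve]; rewrite rescale//.
  apply/sums_toZ/sums_to_scale/he; first by rewrite mulf_neq0.
  by rewrite cabsM c2; lra.
have := sums_to_coef_unique s0 h1 h2 j => hij.
apply/eqP; apply: contraT => a0; case/negP: ij.
have : (2 : C) ^+ i = 2 ^+ j.
  apply: (mulIf a0); rewrite {1}hij mulrA exprVn mulfV ?mul1r ?expf_neq0//.
by move=> /eqP; rewrite -!natrX eqr_nat eqn_exp2l.
Qed.

(** When only diagonal terms survive, [kmom_expansion] gives L_v(Q_n) =
    L(Q_n^2) v^n, but only for v in a disc depending on n. After denominators
    are cleared, the recursion [kmom_gpoly_rec] is an identity between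
    functions analytic on the whole disc of radius r, to which it extends. At
    one fixed v it gives the convergence of T, and then, at every v, the
    formula for the kernel. *)
Lemma product_kernel_of_orthogonal :
  (forall i j, i != j -> momf m (Q i * Q j) = 0) ->
  exists T : C -> C, exists2 d : R, 0 < d &
  (forall z v, z != 0 -> v != 0 -> cabs z < d -> cabs v < d -> z != v ->
     gen_kernel z v = T (z * v)).
Proof.
move=> orth; pose a n := momf m (Q n * Q n).
have diag n : exists2 d : R, 0 < d & forall v, v != 0 -> cabs v < d ->
    momf (kmom v) (Q n) = a n * v ^+ n.
  have [d d0 hd] := kmom_expansion (Q n).
  exists d => // v v0 vd; apply: (sums_to_unique (hd v v0 vd)).
  apply: sums_to_ext (@sums_to_single R (a n) n v) => k.
  case: eqVneq => [->|kn]; first by rewrite mulr1n.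
  by rewrite mulr0n orth// eq_sym.
(* the recursion multiplied by rho v * g v *)
pose rel n v := cprod (fun i => g v * ra i - rho v * g v *+ (i == 0%N))
    (fun k => a k * v ^+ k) n - (rho v * ra n - rho v * g v * ka n).
have relE n v : cabs v < r -> rel n v = 0.
  move: v; apply: analytic_on_eq0 => //.
    have arho : analytic_on r rho by exists ra.
    have ag : analytic_on r g by exists ga.
    have arg : analytic_on r (fun v => rho v * g v) := analytic_onM arho ag.
    have acst c : analytic_on r (fun=> c) by exact: analytic_on_cst.
    apply: (@analytic_onD _ _ (fun v => cprod _ _ n)).
      apply: analytic_on_sum => i; apply: (@analytic_onM _ _ (fun v => _ - _)).
        apply: analytic_onD; first exact: (analytic_onM ag (acst _)).
        apply: analytic_onN; case: (_ == _); last exact: (acst 0).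
        exact: arg.
      apply: (analytic_onM (acst _)).
      by apply: analytic_onX; exact: analytic_on_id.
    apply: analytic_onN; apply: analytic_onD.
      exact: (analytic_onM arho (acst _)).
    by apply: analytic_onN; exact: (analytic_onM arg (acst _)).
  have [d [d0 hd]] : exists d : R, 0 < d /\ forall v, v != 0 -> cabs v < d ->
      forall k, (k <= n)%N -> momf (kmom v) (Q k) = a k * v ^+ k.
    elim: n => [|n [d [d0 hd]]].
      have [d d0 hd] := diag 0%N; exists d; split => // v v0 vd k.
      by rewrite leqn0 => /eqP ->; exact: hd.
    have [e e0 he] := diag n.+1; exists (Num.min d e); split.
      by rewrite lt_min d0.
    move=> v v0; rewrite lt_min => /andP[vd ve] k.
    rewrite leq_eqVlt => /predU1P[->|]; first exact: he.
    by rewrite ltnS; exact: hd.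
  exists (Num.min d r) => [|v v0]; first by rewrite lt_min d0.
  rewrite lt_min => /andP[vd vr]; apply/eqP; rewrite /rel subr_eq0; apply/eqP.
  have rv := rho_neq0 v0 vr; have gv := g_neq0 v0 vr.
  have -> : rho v * ra n - rho v * g v * ka n =
      rho v * g v * ((g v)^-1 * ra n - ka n).
    by rewrite mulrBr; congr (_ - _); rewrite -mulrA mulVKf.
  rewrite -kmom_gpoly_rec /cprod mulr_sumr; apply: eq_bigr => i _.
  rewrite (hd v v0 vd (n - i)%N) ?leq_subr// [RHS]mulrA; congr (_ * _).
  rewrite mulrDr; congr (_ + _).
    by rewrite mulrA [rho v * g v]mulrC mulfK.
  by rewrite mulrnAr mulrN1 mulNrn.
pose T w : C := limn (series (fun n => a n * w ^+ n)).
have [R1 R10 hT] : exists2 R1 : R, 0 < R1 & forall w, cabs w < R1 -> sums_to a w (T w).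
  (* any nonzero v0 in the disc will do: the series of T at w is then that of
     the quotient at w / v0 *)
  pose v0 : C := toC (r / 2).
  have v0r : cabs v0 = r / 2 by rewrite cabs_toC ger0_norm// ltW// divr_gt0.
  have v0lt : cabs v0 < r by rewrite v0r ltr_pdivrMr// ltr_pMr// ltr1n.
  have v00 : v0 != 0 by rewrite -cabs_gt0 v0r divr_gt0.
  have hb : psum (fun i => g v0 * ra i - rho v0 * g v0 *+ (i == 0%N)) r
      (fun z => g v0 * rho z + - (rho v0 * g v0)).
    move=> z zr; apply: sums_toD; first by apply: sums_toZ; exact: rho_psum.
    have := @sums_to_single R (- (rho v0 * g v0)) 0%N z; rewrite expr0 mulr1.
    by apply: sums_to_ext => n; rewrite mulNrn.
  have hka := psum_fill ka_sum.
  have ht : psum (fun n => rho v0 * ra n + (- (rho v0 * g v0)) * ka n) r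
      (fun z => rho v0 * rho z + (- (rho v0 * g v0)) * ka_fun z).
    by move=> z zr; apply: sums_toD; apply: sums_toZ; [exact: rho_psum|exact: hka].
  have b0 : g v0 * ra 0%N - rho v0 * g v0 *+ (0%N == 0%N) != 0.
    by rewrite ra0 mulr0 add0r oppr_eq0 mulf_neq0 ?rho_neq0 ?g_neq0.
  have hs n : cprod (fun i => g v0 * ra i - rho v0 * g v0 *+ (i == 0%N))
      (fun k => a k * v0 ^+ k) n = rho v0 * ra n + (- (rho v0 * g v0)) * ka n.
    by apply/eqP; rewrite mulNr -subr_eq0; apply/eqP; exact: relE.
  have [d d0 hd] := psum_quotient r0 b0 hb ht hs.
  exists (d * (r / 2)) => [|w wd]; first by rewrite mulr_gt0// divr_gt0.
  have /hd : cabs (w / v0) < d by rewrite cabsM cabsV v0r ltr_pdivrMr// divr_gt0.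
  rewrite /sums_to (_ : (fun n => _ * (w / v0) ^+ n) = (fun n => a n * w ^+ n)).
    by move=> /cvgP.
  by apply/funext => n; rewrite -mulrA -exprMn [v0 * _]mulrC divfK.
exists T; exists (Num.min 1 (Num.min r R1)) => [|z v z0 v0].
  by rewrite !lt_min ltr01 r0.
rewrite !lt_min => /and3P[_ zr zR1] /and3P[v1 vr _] zv.
pose r' := Num.min r R1.
have r'r w : cabs w < r' -> cabs w < r by rewrite lt_min => /andP[].
have zr' : cabs z < r' by rewrite lt_min zr.
have hs : psum (fun k => a k * v ^+ k) r' (fun z => T (z * v)).
  move=> w; rewrite lt_min => /andP[_ wR1].
  have /hT : cabs (w * v) < R1.
    rewrite cabsM; apply: le_lt_trans wR1.
    by rewrite ler_piMr ?cabs_ge0// ltW.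
  rewrite /sums_to (_ : (fun n => a n * (w * v) ^+ n) =
    (fun n => a n * v ^+ n * w ^+ n))//.
  by apply/funext => n; rewrite exprMn mulrA mulrAC.
have hb : psum (fun i => g v * ra i - rho v * g v *+ (i == 0%N)) r'
    (fun z => g v * rho z + - (rho v * g v)).
  move=> w /r'r wr; apply: sums_toD; first by apply: sums_toZ; exact: rho_psum.
  have := @sums_to_single R (- (rho v * g v)) 0%N w; rewrite expr0 mulr1.
  by apply: sums_to_ext => n; rewrite mulNrn.
have h1 := psumM hb hs zr'.
have h2 : sums_to (fun n => rho v * ra n + (- (rho v * g v)) * ka n) z
    (rho v * rho z + (- (rho v * g v)) * (rho z / g z)).
  by apply: sums_toD; apply: sums_toZ; [exact: rho_psum|exact: ka_sum].
have hn n : cprod (fun i => g v * ra i - rho v * g v *+ (i == 0%N))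
    (fun k => a k * v ^+ k) n = rho v * ra n + (- (rho v * g v)) * ka n.
  by apply/eqP; rewrite mulNr -subr_eq0; apply/eqP; exact: relE.
have hE := sums_to_unique (sums_to_ext hn h1) h2.
have rz := rho_neq0 z0 zr; have gz := g_neq0 z0 zr.
have rv := rho_neq0 v0 vr; have gv := g_neq0 v0 vr.
have rzv : rho z - rho v != 0.
  by rewrite subr_eq0; apply: contra_neq zv; exact: rho_inj.
have c0 : g v * rho z + - (rho v * g v) != 0.
  by rewrite [rho v * g v]mulrC -mulrBr mulf_neq0.
apply: (mulfI c0); rewrite hE /gen_kernel.
by field; rewrite mulN1r rz gz rv gv rzv.
Qed.

End ProductKernel.

(** * The means of the generated polynomials *)

Section Normalization.
Variable R : realType.
Local Notation C := (Cplx R).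
Variable mu : probability (measurableTypeR R) R.
Hypothesis mu_moments : forall n : nat,
  mu.-integrable [set: measurableTypeR R] (fun x : R => (x ^+ n)%:E).
Variables (rho g : C -> C) (ra ka : nat -> C) (r : R).
Hypothesis r0 : 0 < r.
Hypothesis rho_psum : psum ra r rho.
Hypothesis ra0 : ra 0%N = 0.
Hypothesis ra1 : ra 1%N != 0.
Hypothesis ka_sum : forall z, z != 0 -> cabs z < r ->
  sums_to ka z (rho z / g z).
Hypothesis g_neq0 : forall z, z != 0 -> cabs z < r -> g z != 0.
Hypothesis g_transform : forall z, z != 0 -> cabs z < r ->
  cauchy_stieltjes mu (rho z)^-1 = g z.

Local Notation ka_fun := (fun z => if z == 0 then ka 0%N else rho z / g z).

Lemma psum_lincomb N (c : nat -> C) (a : nat -> nat -> C) (F : nat -> C -> C) :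
  (forall k, psum (a k) r (F k)) ->
  psum (fun n => \sum_(k < N) c k * a k n) r
    (fun z => \sum_(k < N) c k * F k z).
Proof.
move=> ha z zr; elim: N => [|N IH].
  have := @sums_to_single R 0 0%N z; rewrite mul0r big_ord0.
  by apply: sums_to_ext => n; rewrite mul0rn big_ord0.
rewrite big_ord_recr /=.
apply: (sums_to_ext _ (sums_toD IH (sums_toZ (c := c N) (ha N z zr)))) => n.
by rewrite big_ord_recr.
Qed.

Lemma gcoef_psum k : psum (gcoef ra ka k) r (fun z => rho z ^+ k * ka_fun z).
Proof.
have hka := psum_fill ka_sum.
elim: k => [|k IH] z zr; first by rewrite expr0 mul1r; exact: hka.
by rewrite exprS -mulrA; exact: (psumM rho_psum IH).
Qed.

Lemma abs_Im_inv (w : C) :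
  `|complex.Im w^-1| = `|complex.Im w| / cabs w ^+ 2.
Proof.
rewrite cabs_sqr; case: w => x y.
rewrite [X in complex.Im X](_ : _ = Complex (x / (x ^+ 2 + y ^+ 2))
  (- (y / (x ^+ 2 + y ^+ 2))))//=.
by rewrite normrN normrM normfV [`|_ + _|]ger0_norm// addr_ge0 ?sqr_ge0.
Qed.

(** For u = i / rho'(0) and t > 0 small, rho(t u) is close to t i, so it stays
    in a sector around the imaginary axis. *)
Lemma rho_along_ray : exists2 u : C, u != 0 & exists2 d : R, 0 < d &
  forall t : R, 0 < t < d -> [/\ cabs (toC t * u) < r,
     cabs (rho (toC t * u)) <= 2 * t & t / 2 <= complex.Im (rho (toC t * u))].
Proof.
have [f1 hf1 fE] := psum_tail rho_psum.
have [f2 hf2 f1E] := psum_tail hf1.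
have [A A0 [e e0 hA]] := psum_bounded r0 hf2.
pose ii : C := Complex 0 1; pose u := ii / ra 1%N.
have ii0 : ii != 0.
  by apply/eqP => /(congr1 (@complex.Im R)) /= /eqP; rewrite oner_eq0.
have u0 : u != 0 by rewrite mulf_neq0// invr_eq0.
have U0 : 0 < cabs u by rewrite cabs_gt0.
exists u => //.
exists (Num.min (Num.min r e / cabs u) (2 * A * cabs u ^+ 2)^-1).
  by rewrite lt_min divr_gt0 ?lt_min ?r0//= invr_gt0 !mulr_gt0// exprn_gt0.
move=> t /andP[t0]; rewrite lt_min ltr_pdivlMr// lt_min => /andP[/andP[tr te] tA].
have ct : cabs (toC t * u) = t * cabs u by rewrite cabsM cabs_toC gtr0_norm.
pose rem := (toC t * u) ^+ 2 * f2 (toC t * u).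
have rhoE : rho (toC t * u) = toC t * ii + rem.
  rewrite fE ?f1E ?ct// ra0 add0r mulrDr /rem; congr (_ + _).
    by rewrite /u -mulrA divfK.
  by rewrite expr2 mulrA.
have hrem : cabs rem <= t / 2.
  rewrite cabsM cabsX ct.
  apply: (@le_trans _ _ ((t * cabs u) ^+ 2 * A)).
    by rewrite ler_wpM2l ?exprn_ge0 ?mulr_ge0 ?cabs_ge0 ?(ltW t0)// hA// ct.
  have : t * (2 * A * cabs u ^+ 2) <= 1.
    by rewrite -ler_pdivlMr ?mul1r ?(ltW tA)// !mulr_gt0// exprn_gt0.
  move=> h; have := ler_wpM2l (ltW t0) h.
  rewrite (_ : t * (t * _) = 2 * ((t * cabs u) ^+ 2 * A)); last by ring.
  by rewrite mulr1; lra.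
split; first by rewrite ct.
  rewrite rhoE; apply: le_trans (cabsD _ _) _.
  have -> : cabs (toC t * ii) = t.
    rewrite cabsM cabs_toC gtr0_norm// (_ : cabs ii = 1) ?mulr1//.
    apply/eqP; rewrite -(@eqrXn2 _ 2) ?cabs_ge0// cabs_sqr /= expr0n add0r.
    by rewrite !expr1n.
  by lra.
rewrite rhoE Im_add.
have -> : complex.Im (toC t * ii) = t by rewrite Im_mul /= mulr1 mul0r addr0.
have := le_trans (Im_le_cabs rem) hrem; rewrite ler_norml => /andP[h _].
by lra.
Qed.

(** Along the ray of [rho_along_ray], 1 / rho(z) stays in a sector away from
    the real axis, and the asymptotic expansion of g(z) = G(1/rho(z)),
    multiplied by 1 / g(z), says that 1 is the sum of the m_k kappa(z) rho(z)^k
    for k <= n, up to order n + 1. Both sides being analytic, their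
    coefficients of order n agree. *)
Lemma gpoly_mean n : momf (moment mu) (gpoly ra ka n) = 1 *+ (n == 0%N).
Proof.
have [K K0 hK] := cauchy_stieltjes_asymptotics mu_moments n.+1.
have hka := psum_fill ka_sum.
have [B B0 [e e0 hB]] := psum_bounded r0 hka.
have [u u0 [d d0 hd]] := rho_along_ray.
pose m := moment mu.
have hf : psum (fun j => 1 *+ (j == 0%N) +
      (-1) * \sum_(k < n.+1) m k * gcoef ra ka k j) r
    (fun z => 1 + (-1) * \sum_(k < n.+1) m k * (rho z ^+ k * ka_fun z)).
  move=> z zr; apply: sums_toD.
    by have := @sums_to_single R 1 0%N z; rewrite expr0 mulr1.
  by apply: sums_toZ; exact: (@psum_lincomb n.+1 m _ _ gcoef_psum z zr).
have U0 : 0 < cabs u by rewrite cabs_gt0.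
have := @psum_ray_coef0 R u n.+1 _ r _ (16 * B * K * 2 ^+ n.+1)
  (Num.min d (e / cabs u)) u0 r0 hf.
rewrite lt_min d0 divr_gt0// => /(_ isT) hcoef.
have /eqP : (fun j => 1 *+ (j == 0%N) +
      (-1) * \sum_(k < n.+1) m k * gcoef ra ka k j) n = 0.
  apply: hcoef => // t /andP[t0]; rewrite lt_min ltr_pdivlMr// => /andP[td te].
  have /hd[zr hup hlow] : 0 < t < d by rewrite t0.
  set z := toC t * u in zr hup hlow *.
  have z0 : z != 0 by rewrite mulf_neq0// -cabs_gt0 cabs_toC gtr0_norm.
  have ze : cabs z < e by rewrite cabsM cabs_toC gtr0_norm.
  have t2 : 0 < t / 2 by lra.
  have Im0 : 0 < complex.Im (rho z) by lra.
  have cr : t / 2 <= cabs (rho z).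
    by apply: le_trans (Im_le_cabs _); rewrite ger0_norm// ltW.
  have cr0 : 0 < cabs (rho z) by lra.
  have rz : rho z != 0 by rewrite -cabs_gt0.
  have gz := g_neq0 z0 zr.
  have ImV : `|complex.Im (rho z)^-1|^-1 <= 8 * t.
    rewrite abs_Im_inv invf_div gtr0_norm// ler_pdivrMr//.
    apply: (@le_trans _ _ ((2 * t) ^+ 2)).
      by apply: lerXn2r; rewrite ?nnegrE ?cabs_ge0//; lra.
    have := ler_wpM2l (ltW t0) hlow; rewrite expr2; nra.
  have ImV0 : complex.Im (rho z)^-1 != 0.
    by rewrite -normr_gt0 abs_Im_inv divr_gt0 ?exprn_gt0// gtr0_norm.
  have := hK _ ImV0; rewrite g_transform// invrK => hz.
  have hz' : cabs (g z - \sum_(k < n.+1) rho z ^+ k.+1 * m k) <=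
      K * (2 * t) ^+ n.+1 * (8 * t).
    apply: le_trans hz _.
    apply: ler_pM; rewrite ?mulr_ge0 ?exprn_ge0 ?cabs_ge0 ?invr_ge0//.
    rewrite ler_wpM2l//.
    by apply: lerXn2r; rewrite ?nnegrE ?cabs_ge0//; lra.
  rewrite (negPf z0).
  have -> : 1 + (-1) * (\sum_(k < n.+1) m k * (rho z ^+ k * (rho z / g z))) =
      (rho z / g z) * (rho z)^-1 * (g z - \sum_(k < n.+1) rho z ^+ k.+1 * m k).
    have -> : \sum_(k < n.+1) m k * (rho z ^+ k * (rho z / g z)) =
        (\sum_(k < n.+1) rho z ^+ k.+1 * m k) / g z.
      by rewrite mulr_suml; apply: eq_bigr => k _; rewrite exprS; ring.
    by field; rewrite rz gz.
  rewrite !cabsM !cabsV.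
  have hB' := hB z ze; rewrite (negPf z0) cabsM cabsV in hB'.
  have -> : 16 * B * K * 2 ^+ n.+1 * t ^+ n.+1 =
      (B * (t / 2)^-1) * (K * (2 * t) ^+ n.+1 * (8 * t)).
    rewrite exprMn; field; exact: lt0r_neq0.
  apply: ler_pM; rewrite ?mulr_ge0 ?invr_ge0 ?cabs_ge0//.
  apply: ler_pM; rewrite ?(mulr_ge0, invr_ge0, cabs_ge0)//.
  by rewrite lef_pV2.
rewrite mulN1r subr_eq0 => /eqP ->.
rewrite (@momf_wide _ n.+1) ?size_poly//; apply: eq_bigr => k _.
by rewrite coef_gpoly// mulrC.
Qed.

End Normalization.

(** * The inverse of F, and generating functions *)

Section Reduction.
Variable R : realType.
Local Notation C := (Cplx R).
Variable mu : probability (measurableTypeR R) R.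

Lemma psum_sub (a : nat -> C) (r r' : R) f :
  r' <= r -> psum a r f -> psum a r' f.
Proof. by move=> rr h z zr; apply: h; exact: lt_le_trans rr. Qed.

Lemma expands_at0_unique (f : C -> C) (a b : nat -> C) :
  expands_at0 f a -> expands_at0 f b -> a =1 b.
Proof.
move=> /dnear0P[d d0 ha] /dnear0P[e e0 hb].
have de : 0 < Num.min d e by rewrite lt_min d0.
apply: (sums_to_coef_unique de) => z z0; rewrite lt_min => /andP[zd ze].
  exact: ha.
exact: hb.
Qed.

(** For each real x the expansion of psi(.,x) is unique, and a polynomial is
    determined by its values on the real line, so the polynomials of a
    generating function are the given ones. *)
Lemma generatingP (psi : C -> R -> C) (Q : nat -> {poly C}) :
  (forall n : nat, mu.-integrable [set: measurableTypeR R]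
     (fun x : R => (x ^+ n)%:E)) ->
  (forall x, expands_at0 (psi ^~ x) (fun n => (Q n).[toC x])) ->
  (forall n, size (Q n) = n.+1) ->
  generating mu psi <->
  (forall i j, i != j -> momf (moment mu) (Q i * Q j) = 0).
Proof.
move=> mom hQ szQ.
have mr k : (moment mu k)^* = moment mu k by exact: conj_toC.
have herm p q : cintegral mu (fun x => p.[toC x] * (q.[toC x])^*) =
    momf (moment mu) (p * map_poly Num.conj q).
  rewrite -(moment_poly mom _).2; congr cintegral; apply/funext => x.
  by rewrite hornerM -[in RHS](conj_toC x) horner_map /= conj_toC.
rewrite -momf_orthogonal_conj//; split.
  move=> [Q' [hQ' orth]] i j ij.
  have QE n : Q' n = Q n.
    apply/eqP; rewrite -subr_eq0; apply/eqP/poly_toC_eq0 => x.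
    rewrite hornerD hornerN; apply/eqP; rewrite subr_eq0; apply/eqP.
    exact: (expands_at0_unique (hQ' x) (hQ x)).
  by rewrite -herm -!QE orth.
move=> orth; exists Q; split=> // i j ij.
by rewrite herm orth.
Qed.

(** If F had no right inverse near infinity, the default choice would make K
    identically zero, hence rho(z) = 0. *)
Lemma F_inv_right_inverse (rho g : C -> C) (d : R) : 0 < d ->
  (forall z, z != 0 -> cabs z < d -> rho z != 0) ->
  (forall z, z != 0 -> cabs z < d -> (rho z)^-1 = K_transform mu (g z)) ->
  F_right_inverse mu (F_inv mu).
Proof.
move=> d0 rho0 hK; rewrite /F_inv.
have [[h hh]|nex] := pselect (exists h, F_right_inverse mu h).
  by apply: (@xgetPex _ _ [set h | F_right_inverse mu h]); exists h.
pose z : C := toC (d / 2).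
have zd : cabs z = d / 2 by rewrite cabs_toC gtr0_norm// divr_gt0.
have z0 : z != 0 by rewrite -cabs_gt0 zd divr_gt0.
have zd' : cabs z < d by rewrite zd ltr_pdivrMr// ltr_pMr// ltr1n.
have := hK z z0 zd'; rewrite /K_transform /F_inv xgetPN => [/eqP|h hh].
  by rewrite invr_eq0 (negPf (rho0 z z0 zd')).
by apply: nex; exists h.
Qed.

(** As g(z) tends to zero, 1 / g(z) enters the neighborhood of infinity where F
    is inverted. *)
Lemma cauchy_stieltjes_inverse (rho g : C -> C) (ga : nat -> C) (r : R) :
  0 < r -> psum ga r g -> g 0 = 0 ->
  (forall z, z != 0 -> cabs z < r -> rho z != 0) ->
  (forall z, z != 0 -> cabs z < r -> g z != 0) ->
  (forall z, z != 0 -> cabs z < r -> (rho z)^-1 = K_transform mu (g z)) ->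
  exists2 d : R, 0 < d & forall z, z != 0 -> cabs z < d ->
    cauchy_stieltjes mu (rho z)^-1 = g z.
Proof.
move=> r0 hg g00 rho0 g0 hK.
have [M [N [_ hF]]] := F_inv_right_inverse r0 rho0 hK.
have [g1 hg1 gE] := psum_tail hg.
have [A A0 [e e0 hA]] := psum_bounded r0 hg1.
have ga0 : ga 0%N = 0 by rewrite -(psum0E r0 hg).
have N0 : 0 < `|N| + 1 by rewrite ltr_wpDl.
exists (Num.min (Num.min r e) (A * (`|N| + 1))^-1).
  by rewrite !lt_min r0 e0 invr_gt0 mulr_gt0.
move=> z z0; rewrite !lt_min => /andP[/andP[zr ze]] zN.
have gz := g0 z z0 zr; have cg : 0 < cabs (g z) by rewrite cabs_gt0.
have small : cabs (g z) * (`|N| + 1) < 1.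
  rewrite gE// ga0 add0r cabsM.
  apply: (@le_lt_trans _ _ (cabs z * (A * (`|N| + 1)))).
    by rewrite -mulrA ler_wpM2l ?cabs_ge0// ler_wpM2r ?hA// ltW.
  by rewrite -ltr_pdivlMr ?mulr_gt0// mul1r.
have : toC N < `|(g z)^-1|.
  rewrite -toC_cabs ltr_toC cabsV -[X in _ < X]mul1r ltr_pdivlMr//.
  apply: le_lt_trans small; rewrite mulrC ler_wpM2l ?cabs_ge0//.
  by apply: le_trans (ler_norm N) _; rewrite lerDl.
move=> /hF[_]; have := hK z z0 zr; rewrite /K_transform => <-.
by rewrite /F_transform => /invr_inj.
Qed.

End Reduction.

Theorem theorem2p2 (R : realType) (mu : probability (measurableTypeR R) R)
    (g rho : Cplx R -> Cplx R)
    (mu_moments : forall n : nat,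
       mu.-integrable [set: measurableTypeR R] (fun x : R => (x ^+ n)%:E))
    (mu_mean : ('E_mu[idfun : measurableTypeR R -> R] = 0)%E)
    (mu_variance : ('V_mu[idfun : measurableTypeR R -> R] = 1)%E)
    (mu_support : infinite_set (measure_support mu))
    (g_analytic : analytic_at0 g) (g0 : g 0 = 0) (dg0 : derive1 g 0 != 0)
    (rho_analytic : analytic_at0 rho) (rho0 : rho 0 = 0)
    (drho0 : derive1 rho 0 != 0)
    (rho_g : \forall z \near (0 : Cplx R)^', (rho z)^-1 = K_transform mu (g z))
    (pre_gen : pre_generating mu (fun z x => (1 - rho z * toC x)^-1)) :
  generating mu (fun z x => (g z * (K_transform mu (g z) - toC x))^-1)
  <->
  depends_on_product (fun z v =>
    (voiculescu mu ((g z)^-1) - voiculescu mu ((g v)^-1))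
    / ((g z)^-1 - (g v)^-1)).
Proof.
have [ga /near0P[rg rg0 hg]] := g_analytic.
have [ra /near0P[rr rr0 hr]] := rho_analytic.
have ga0 : ga 0%N = 0 by rewrite -(psum0E rg0 hg).
have ra0 : ra 0%N = 0 by rewrite -(psum0E rr0 hr).
have ga1 := analytic_derive1_neq0 rg0 hg dg0.
have ra1 := analytic_derive1_neq0 rr0 hr drho0.
have [dg dg_gt0 g_inj] := psum_injective rg0 hg ga1.
have [dr dr_gt0 rho_inj] := psum_injective rr0 hr ra1.
have /dnear0P[dK dK_gt0 hK] := rho_g.
(* the power series of rho / g *)
have [ka hka] :=
  @cprod_quotient_exists R (fun n => ga n.+1) (fun n => ra n.+1) ga1.
have ka_rec n : cprod ga ka n = ra n.
  case: n => [|n]; first by rewrite /cprod big_ord1 ga0 mul0r ra0.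
  rewrite -hka /cprod big_ord_recl ga0 mul0r add0r.
  by apply: eq_bigr => i _; rewrite lift0 subSS.
have ka0 : ka 0%N != 0.
  apply: contra_neq ra1 => k0.
  by rewrite -ka_rec /cprod !big_ord_recl big_ord0 ga0 mul0r /= k0 mulr0 !addr0.
pose r1 := Num.min (Num.min rg rr) (Num.min (Num.min dg dr) dK).
have r10 : 0 < r1 by rewrite !lt_min rg0 rr0 dg_gt0 dr_gt0.
have r1P : [/\ r1 <= rg, r1 <= rr, r1 <= dg, r1 <= dr & r1 <= dK].
  by rewrite /r1; split; rewrite !ge_min lexx ?orbT.
have [r1g r1r r1dg r1dr r1K] := r1P.
clearbody r1.
have hg1 := psum_sub r1g hg; have hr1 := psum_sub r1r hr.
have rho_neq0 z : z != 0 -> cabs z < r1 -> rho z != 0.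
  move=> z0 zr; apply: contra_neq z0 => rz; apply: rho_inj; last by rewrite rho0.
    exact: lt_le_trans r1dr.
  by rewrite cabs0.
have g_neq0 z : z != 0 -> cabs z < r1 -> g z != 0.
  move=> z0 zr; apply: contra_neq z0 => rz; apply: g_inj; last by rewrite g0.
    exact: lt_le_trans r1dg.
  by rewrite cabs0.
have hK1 z : z != 0 -> cabs z < r1 -> (rho z)^-1 = K_transform mu (g z).
  by move=> z0 zr; apply: hK => //; exact: lt_le_trans r1K.
have [d1 d10 hcs] := cauchy_stieltjes_inverse r10 hg1 g0 rho_neq0 g_neq0 hK1.
have [d2 d20 hks] := psum_quotient_simple_zero r10 ga0 ga1 hg1 hr1 ka_rec.
pose r := Num.min r1 (Num.min d1 d2).
have r_gt0 : 0 < r by rewrite !lt_min r10 d10.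
have [rr1 rd1 rd2] : [/\ r <= r1, r <= d1 & r <= d2].
  by rewrite /r; split; rewrite !ge_min lexx ?orbT.
clearbody r.
have sub z : cabs z < r -> cabs z < r1 by move=> h; exact: lt_le_trans rr1.
have rho_psum := psum_sub rr1 hr1; have g_psum := psum_sub rr1 hg1.
have ka_sum z : z != 0 -> cabs z < r -> sums_to ka z (rho z / g z).
  by move=> z0 zr; apply: hks => //; exact: lt_le_trans rd2.
have transf z : z != 0 -> cabs z < r -> cauchy_stieltjes mu (rho z)^-1 = g z.
  by move=> z0 zr; apply: hcs => //; exact: lt_le_trans rd1.
have Q_mean := gpoly_mean mu_moments r_gt0 rho_psum ra0 ra1 ka_sum
  (fun z z0 zr => g_neq0 z z0 (sub z zr)) transf.
have ratio_E z v : z != 0 -> v != 0 -> cabs z < r -> cabs v < r -> z != v ->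
    (voiculescu mu ((g z)^-1) - voiculescu mu ((g v)^-1))
    / ((g z)^-1 - (g v)^-1) = (gen_kernel rho g z v)^-1 - 1.
  move=> z0 v0 zr vr zv.
  have vE w : w != 0 -> cabs w < r -> voiculescu mu (g w)^-1 = (rho w)^-1 - (g w)^-1.
    by move=> w0 wr; rewrite hK1// ?sub.
  rewrite !vE// /gen_kernel invf_div.
  have gzv : (g z)^-1 - (g v)^-1 != 0.
    rewrite subr_eq0; apply: contra_neq zv => /invr_inj; apply: g_inj;
    by apply: lt_le_trans r1dg; exact: sub.
  rewrite -(opprB (rho z)^-1 (rho v)^-1) -(opprB (g z)^-1 (g v)^-1) invrN mulrNN.
  have -> : (rho z)^-1 - (g z)^-1 - ((rho v)^-1 - (g v)^-1) =
    (rho z)^-1 - (rho v)^-1 - ((g z)^-1 - (g v)^-1) by ring.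
  by rewrite mulrBl divff.
have psi_expands x : expands_at0
    (fun z => (g z * (K_transform mu (g z) - toC x))^-1)
    (fun n => (gpoly ra ka n).[toC x]).
  have hka' := psum_fill ka_sum.
  have hb : psum (fun i => 1 *+ (i == 0%N) - toC x * ra i) r
      (fun z => 1 + (- toC x) * rho z).
    move=> z zr; have := sums_toD (@sums_to_single R 1 0%N z)
      (sums_toZ (c := - toC x) (rho_psum z zr)).
    by rewrite expr0 mulr1; apply: sums_to_ext => n; rewrite mulNr.
  have b0 : 1 *+ (0%N == 0%N) - toC x * ra 0%N != 0.
    by rewrite ra0 mulr0 subr0 oner_neq0.
  have [d d0 hd] := psum_quotient r_gt0 b0 hb hka' (gpoly_horner_rec ka ra0 (toC x)).
  apply/dnear0P; exists (Num.min d r) => [|z z0]; first by rewrite lt_min d0.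
  rewrite lt_min => /andP[zd zr]; have := hd z zd; rewrite (negPf z0).
  suff -> : rho z / g z / (1 + - toC x * rho z) =
      (g z * (K_transform mu (g z) - toC x))^-1 by [].
  rewrite -hK1 ?sub//.
  have rz := rho_neq0 z z0 (sub z zr).
  have -> : 1 + - toC x * rho z = rho z * ((rho z)^-1 - toC x).
    by rewrite mulrBr divff// mulNr mulrC.
  by rewrite !invfM mulrA [rho z / g z]mulrC mulfK.
have szQ n : size (gpoly ra ka n) = n.+1 by exact: size_gpoly.
rewrite (generatingP mu_moments psi_expands szQ).
split.
  move=> /(product_kernel_of_orthogonal r_gt0 rho_psum g_psum ra0 ra1 ka_sum
    (fun z z0 zr => rho_neq0 z z0 (sub z zr))
    (fun z z0 zr => g_neq0 z z0 (sub z zr))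
    (fun z w zr wr => rho_inj z w (lt_le_trans (sub z zr) r1dr)
      (lt_le_trans (sub w wr) r1dr)) Q_mean)[T [d d0 hT]].
  exists (fun w => (T w)^-1 - 1); apply/dnear0_2P.
  exists (Num.min d r) => [|z v z0 v0]; first by rewrite lt_min d0.
  rewrite !lt_min => /andP[zd zr] /andP[vd vr] zv.
  by rewrite ratio_E// hT.
move=> [T /dnear0_2P[d d0 hT]].
apply: (orthogonal_of_product_kernel r_gt0 rho_psum ra0 ra1 ka_sum
    (fun z z0 zr => rho_neq0 z z0 (sub z zr))
    (fun z z0 zr => g_neq0 z z0 (sub z zr)) Q_mean
    (T := fun w => (T w + 1)^-1) (d := Num.min d r)); first by rewrite lt_min d0.
move=> z v z0 v0; rewrite !lt_min => /andP[zd zr] /andP[vd vr] zv.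
by rewrite -hT// ratio_E// subrK invrK.
Qed.
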